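(* In the sense of analytic continuation in the parameter $\phi$, $$\int_{0}^{\infty}\operatorname{Im}\!\left(\eta\!\left(\tfrac12+iv\right)\right)v\,dv=0;$$ that is, $$\lim_{\phi\to\pi^{-}}\int_{0}^{\infty}\operatorname{Im}\!\left(\eta\!\left(\tfrac12+iv\right)\right)v\,\frac{\cosh(\phi v)}{\cosh(\pi v)}\,dv=0.$$
   Context: $\eta(s)=\sum_{k=0}^{\infty}(-1)^k/(k+1)^s=(1-2^{1-s})\zeta(s)$ for $\Re(s)>0$ is Dirichlet's eta (alternating zeta) function. The undamped integral is not claimed to converge; it is assigned the value, continued to $\phi=\pi$, of the damped integral with factor $\cosh(\phi v)/\cosh(\pi v)$, which converges for real $|\phi|<\pi$. *)

(* Defs.v *)
From Stdlib Require Import Reals.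
From Coquelicot Require Import Coquelicot.

Open Scope R_scope.

Definition Cexp (z : C) : C := (exp (Re z) * cos (Im z), exp (Re z) * sin (Im z)).

(* x ^ s = exp (s * ln x), principal branch; meant for x > 0 only. *)
Definition Cpow (x : R) (s : C) : C := Cexp (s * RtoC (ln x))%C.

Definition eta_term (s : C) (k : nat) : C :=
  (RtoC ((-1) ^ k) / Cpow (INR k + 1) s)%C.

(* Dirichlet's eta function, the value of the series for 0 < Re s; the complex
   series is summed (conditionally) by real and imaginary parts. *)
Definition eta (s : C) : C :=
  (Series (fun k => Re (eta_term s k)), Series (fun k => Im (eta_term s k))).

Definition damped_integrand (phi v : R) : R :=
  Im (eta (RtoC (1 / 2) + Ci * RtoC v)%C) * v * (cosh (phi * v) / cosh (PI * v)).

Definition ex_damped_integral (phi : R) : Prop :=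
  ex_RInt_gen (damped_integrand phi) (at_point 0) (Rbar_locally p_infty).

Definition damped_integral (phi : R) : R :=
  RInt_gen (damped_integrand phi) (at_point 0) (Rbar_locally p_infty).

(* The function g on the real interval (a, b) has an analytic continuation to b,
   where it takes the value l. Connectedness of U need not be required: the
   component of U containing (a, b] is open and will do, and on it F is
   determined by g. The derivative is the complex one. *)
Definition analytic_continuation_value (g : R -> R) (a b l : R) : Prop :=
  exists (U : C -> Prop) (F : C -> C),
    open U /\
    (forall x : R, a < x <= b -> U (RtoC x)) /\
    (forall z : C, U z -> ex_derive (K := C_AbsRing) (V := C_NormedModule) F z) /\
    (forall x : R, a < x < b -> F (RtoC x) = RtoC (g x)) /\
    F (RtoC b) = RtoC l.

(* Main.v *)
(** Put [eps = PI - phi].  Since [cosh (phi v) / cosh (PI v) = exp (- eps v) +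
    tau v * sinh (eps v)] with [tau v = exp (- PI v) / cosh (PI v)], the damped integral is
    the Laplace transform at [eps] of [v * Im (eta (1/2 + i v))] plus half of
    [E eps - E (- eps)], where [E z] is the integral of [v * Im (eta (1/2 + i v)) * tau v *
    exp (z v)], holomorphic for [Re z < 2 PI] because eta grows linearly on the critical
    line.  Integrating the eta series term by term, the first part is
    [(V eps - V (- eps)) / (2 i)] with
    [V z = sum_(n >= 2) (-1)^n n^(-1/2) / (z - i ln n)^2], holomorphic for [Im z < ln 2];
    the term [n = 1], which would be singular at [z = 0], vanishes since [ln 1 = 0].
    Hence the damped integral extends to an odd holomorphic function of [eps], which is
    zero at [eps = 0].  The alternating sums converge only conditionally; they are
    controlled by applying [alternating_series] to products of [n^(-1/2)] with bounded
    Lipschitz functions of [ln n].  *)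

Require Import Defs.
From Stdlib Require Import Reals.
From Coquelicot Require Import Coquelicot.
From Stdlib Require Import Lra Lia Psatz.

Open Scope R_scope.

(** * Alternating series and the growth of eta on the critical line *)

(** Averaging neighbouring terms gives the partial sum up to [n] as [a 0 / 2], plus the sum of
    [(-1)^k (a k - a (k+1)) / 2], plus half of [(-1)^n a (n+1)]. The middle sum converges
    absolutely, being dominated by a telescoping series in [b], and the last term tends to zero.
    Each of the first two parts costs at most half of [M * b 0]. *)
Lemma alternating_series (a b : nat -> R) (M : R) :
  (forall k, Rabs (a k) <= M * b k) ->
  (forall k, Rabs (a k - a (S k)) <= M * (b k - b (S k))) ->
  is_lim_seq b 0 ->
  ex_series (fun k => (-1) ^ k * a k) /\
  Rabs (Series (fun k => (-1) ^ k * a k)) <= M * b O.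
Proof.
intros Ha Hd Hb.
set (d := fun k => / 2 * ((-1) ^ k * (a k - a (S k)))).
set (e := fun k => / 2 * (M * (b k - b (S k)))).
assert (Habs1 : forall k, Rabs ((-1) ^ k) = 1) by (intro k; apply pow_1_abs).
assert (Hde : forall k, Rabs (d k) <= e k).
{ intro k; unfold d, e; rewrite !Rabs_mult, Habs1, (Rabs_pos_eq (/ 2)) by lra.
  specialize (Hd k); lra. }
assert (He : is_series e (/ 2 * (M * b O))).
{ change (is_lim_seq (sum_n e) (/ 2 * (M * b O))).
  apply is_lim_seq_ext with (fun n => / 2 * (M * (b O - b (S n)))).
  - intro n; induction n as [|n IH].
    + now rewrite sum_O.
    + rewrite sum_Sn, <- IH; unfold e, plus; simpl; lra.
  - replace (Finite (/ 2 * (M * b O))) with (Finite (/ 2 * (M * (b O - 0))))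
      by (f_equal; ring).
    apply is_lim_seq_mult'; [apply is_lim_seq_const|].
    apply is_lim_seq_mult'; [apply is_lim_seq_const|].
    apply is_lim_seq_minus'; [apply is_lim_seq_const|].
    now apply -> is_lim_seq_incr_1. }
assert (Had : ex_series (fun k => Rabs (d k))).
{ apply (@ex_series_le R_AbsRing R_CompleteNormedModule) with e.
  - intro n. change (Rabs (Rabs (d n)) <= e n). now rewrite Rabs_Rabsolu.
  - now exists (/ 2 * (M * b O)). }
assert (Hdb : Rabs (Series d) <= / 2 * (M * b O)).
{ eapply Rle_trans; [now apply Series_Rabs|].
  rewrite <- (is_series_unique _ _ He).
  apply Series_le; [intro; split; [apply Rabs_pos|apply Hde]|eexists; apply He]. }
assert (Ha0 : is_lim_seq (fun n => (-1) ^ n * a (S n)) 0).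
{ apply is_lim_seq_abs_0.
  apply is_lim_seq_le_le with (fun _ => 0) (fun n => M * b (S n)).
  - intro n; rewrite Rabs_mult, Habs1, Rmult_1_l; split; [apply Rabs_pos|apply Ha].
  - apply is_lim_seq_const.
  - replace (Finite 0) with (Finite (M * 0)) by (f_equal; ring).
    apply is_lim_seq_mult'; [apply is_lim_seq_const|].
    now apply -> is_lim_seq_incr_1. }
assert (Hs : is_series (fun k => (-1) ^ k * a k) (/ 2 * a O + Series d + / 2 * 0)).
{ change (is_lim_seq (sum_n (fun k => (-1) ^ k * a k)) (/ 2 * a O + Series d + / 2 * 0)).
  apply is_lim_seq_ext with
    (fun n => / 2 * a O + sum_n d n + / 2 * ((-1) ^ n * a (S n))).
  - intro n; induction n as [|n IH].
    + rewrite !sum_O; unfold d; simpl; lra.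
    + rewrite !sum_Sn, <- IH; unfold d, plus; simpl; lra.
  - apply is_lim_seq_plus'; [apply is_lim_seq_plus'; [apply is_lim_seq_const|]|].
    + apply (Series_correct d), ex_series_Rabs, Had.
    + apply is_lim_seq_mult'; [apply is_lim_seq_const|exact Ha0]. }
split; [eexists; apply Hs|].
rewrite (is_series_unique _ _ Hs).
specialize (Ha O).
eapply Rle_trans; [apply Rabs_triang|]. rewrite Rmult_0_r, Rabs_R0, Rplus_0_r.
eapply Rle_trans; [apply Rabs_triang|].
rewrite Rabs_mult, (Rabs_pos_eq (/ 2)) by lra. lra.
Qed.

(* Indices are shifted by one as in [eta_term]: [isq k] and [lnS k] are n^(-1/2) and ln n
   for n = k + 1. *)
Definition isq (k : nat) : R := / sqrt (INR k + 1).
Definition lnS (k : nat) : R := ln (INR k + 1).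

Lemma isq_pos k : 0 < isq k.
Proof. apply Rinv_0_lt_compat, sqrt_lt_R0; pose proof (pos_INR k); lra. Qed.

Lemma isq_decr k : isq (S k) <= isq k.
Proof.
unfold isq; pose proof (pos_INR k); apply Rinv_le_contravar.
- apply sqrt_lt_R0; lra.
- apply sqrt_le_1_alt; rewrite S_INR; lra.
Qed.

Lemma isq_le_1 k : isq k <= 1.
Proof.
unfold isq; pose proof (pos_INR k); apply Rle_trans with (/ 1); [|lra].
apply Rinv_le_contravar; [lra|]. rewrite <- sqrt_1 at 1. apply sqrt_le_1_alt; lra.
Qed.

Lemma is_lim_seq_isq : is_lim_seq isq 0.
Proof.
unfold isq. replace (Finite 0) with (Rbar_inv p_infty) by reflexivity.
apply is_lim_seq_inv; [|discriminate].
apply (is_lim_comp_seq sqrt (fun n => INR n + 1) p_infty p_infty).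
- apply filterlim_sqrt_p.
- exists O; intros n _; discriminate.
- apply is_lim_seq_ext with (fun n => INR (S n)); [intro n; apply S_INR|].
  apply -> is_lim_seq_incr_1. apply is_lim_seq_INR.
Qed.

Lemma lnS_incr k n : (k <= n)%nat -> lnS k <= lnS n.
Proof.
intro H; apply le_INR in H; pose proof (pos_INR k); unfold lnS.
apply ln_le; lra.
Qed.

(* With s = sqrt n and t = sqrt (n + 1), ln (n + 1) - ln n = 2 ln (t / s) <= 2 (t - s) / s. *)
Lemma lnS_diff k : isq (S k) * (lnS (S k) - lnS k) <= 2 * (isq k - isq (S k)).
Proof.
unfold isq, lnS; rewrite S_INR; pose proof (pos_INR k).
set (x := INR k + 1); assert (0 < x) by (unfold x; lra).
assert (Hs : 0 < sqrt x) by (apply sqrt_lt_R0; lra).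
assert (Ht : 0 < sqrt (x + 1)) by (apply sqrt_lt_R0; lra).
replace (ln x) with (ln (sqrt x * sqrt x)) by (f_equal; apply sqrt_sqrt; lra).
replace (ln (x + 1)) with (ln (sqrt (x + 1) * sqrt (x + 1)))
  by (f_equal; apply sqrt_sqrt; lra).
set (s := sqrt x) in *; set (t := sqrt (x + 1)) in *.
assert (Hl : ln (t * t) - ln (s * s) <= 2 * (t / s - 1)).
{ rewrite !ln_mult by lra.
  assert (ln t = ln (t / s) + ln s).
  { rewrite <- ln_mult; [f_equal; field; lra|apply Rdiv_lt_0_compat; lra|lra]. }
  assert (Hq : 0 < t / s) by (apply Rdiv_lt_0_compat; lra).
  pose proof (exp_ineq1_le (ln (t / s))) as He; rewrite exp_ln in He by lra; lra. }
replace (2 * (/ s - / t)) with (/ t * (2 * (t / s - 1))) by (field; lra).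
apply Rmult_le_compat_l; [left; now apply Rinv_0_lt_compat|exact Hl].
Qed.

(** A consecutive difference of [isq * psi] splits by the product rule; boundedness handles the
    change of [isq], and the Lipschitz bound with [lnS_diff] handles the change of [psi]. Both are
    multiples of [isq n - isq (S n)], so [isq] serves as the dominating sequence. The offset [n0]
    covers tails of eta as well as series starting at n = 2. *)
Lemma alternating_log_series (psi : R -> R) (B K : R) (n0 : nat) :
  (forall x, lnS n0 <= x -> Rabs (psi x) <= B) ->
  (forall x y, lnS n0 <= x -> lnS n0 <= y ->
     Rabs (psi x - psi y) <= K * Rabs (x - y)) ->
  0 <= K ->
  ex_series (fun k => (-1) ^ k * (isq (k + n0) * psi (lnS (k + n0)))) /\
  Rabs (Series (fun k => (-1) ^ k * (isq (k + n0) * psi (lnS (k + n0)))))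
    <= (B + 2 * K) * isq n0.
Proof.
intros HB HK HK0.
assert (HB0 : 0 <= B) by (eapply Rle_trans; [apply Rabs_pos|apply (HB (lnS n0)); lra]).
apply (alternating_series (fun k => isq (k + n0) * psi (lnS (k + n0)))
         (fun k => isq (k + n0))).
- intro k; pose proof (isq_pos (k + n0)).
  rewrite Rabs_mult, Rabs_pos_eq, Rmult_comm by lra.
  apply Rmult_le_compat_r; [lra|].
  eapply Rle_trans; [apply HB, lnS_incr; lia|lra].
- intro k; change (S k + n0)%nat with (S (k + n0)); set (n := (k + n0)%nat).
  pose proof (isq_pos n); pose proof (isq_pos (S n)); pose proof (isq_decr n).
  assert (Hx : lnS n0 <= lnS n) by (apply lnS_incr; unfold n; lia).
  assert (Hxy : lnS n <= lnS (S n)) by (apply lnS_incr; lia).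
  replace (isq n * psi (lnS n) - isq (S n) * psi (lnS (S n))) with
    ((isq n - isq (S n)) * psi (lnS n) + isq (S n) * (psi (lnS n) - psi (lnS (S n))))
    by ring.
  eapply Rle_trans; [apply Rabs_triang|]. rewrite !Rabs_mult.
  rewrite (Rabs_pos_eq (isq n - isq (S n))), (Rabs_pos_eq (isq (S n))) by lra.
  pose proof (HB _ Hx) as H2.
  assert (H3 := HK (lnS n) (lnS (S n)) Hx ltac:(lra)).
  rewrite (Rabs_minus_sym (lnS n)), (Rabs_pos_eq (lnS (S n) - _)) in H3 by lra.
  pose proof (lnS_diff n) as H4.
  apply (Rmult_le_compat_l (isq n - isq (S n))) in H2; [|lra].
  apply (Rmult_le_compat_l (isq (S n))) in H3; [|lra].
  apply (Rmult_le_compat_l K) in H4; [|lra].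
  nra.
- apply -> is_lim_seq_incr_n. apply is_lim_seq_isq.
Qed.

(** * The imaginary part of eta on the critical line *)

Definition im_eta (v : R) : R := Im (eta (RtoC (1 / 2) + Ci * RtoC v)%C).
Definition im_eta_term (v : R) (k : nat) : R := (-1) ^ k * (isq k * - sin (v * lnS k)).

Lemma Im_eta_term v k :
  Im (eta_term (RtoC (1 / 2) + Ci * RtoC v)%C k) = im_eta_term v k.
Proof.
unfold eta_term, im_eta_term, Cpow, Cexp, isq, lnS; simpl.
pose proof (pos_INR k); set (L := ln (INR k + 1)).
replace ((1 / 2 + (0 * v - 1 * 0)) * L - (0 + (0 * 0 + 1 * v)) * 0) with (L / 2) by field.
replace ((1 / 2 + (0 * v - 1 * 0)) * 0 + (0 + (0 * 0 + 1 * v)) * L) with (v * L) by field.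
assert (HL : exp (L / 2) = sqrt (INR k + 1)).
{ symmetry; apply sqrt_lem_1; [lra|left; apply exp_pos|].
  rewrite <- exp_plus; replace (L / 2 + L / 2) with L by field.
  apply exp_ln; lra. }
rewrite HL; assert (0 < sqrt (INR k + 1)) by (apply sqrt_lt_R0; lra).
set (s := sqrt (INR k + 1)) in *.
(* The complex division introduces the squared modulus of n^s, which is n. *)
assert (Hn : s * cos (v * L) * (s * cos (v * L) * 1) + s * sin (v * L) * (s * sin (v * L) * 1)
        = s * s).
{ pose proof (sin2_cos2 (v * L)) as H1; unfold Rsqr in H1.
  transitivity (s * s * (sin (v * L) * sin (v * L) + cos (v * L) * cos (v * L))); [ring|].
  rewrite H1; ring. }
rewrite Hn; field; lra.
Qed.

(** The function [x => - sin (v * x)] is bounded by 1 and has Lipschitz constant [Rabs v]; the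
    latter is the source of the linear growth in [v]. *)
Lemma im_eta_tail v n0 :
  ex_series (fun k => im_eta_term v (k + n0)) /\
  Rabs (Series (fun k => im_eta_term v (k + n0))) <= (1 + 2 * Rabs v) * isq n0.
Proof.
destruct (alternating_log_series (fun x => - sin (v * x)) 1 (Rabs v) n0) as [H1 H2].
- intros x _; rewrite Rabs_Ropp; apply Rabs_le, SIN_bound.
- intros x y _ _.
  replace (- sin (v * x) - - sin (v * y)) with (sin (v * y) - sin (v * x)) by ring.
  destruct (MVT_gen sin (v * x) (v * y) cos) as [c [_ Hc]].
  + intros; apply is_derive_Reals, derivable_pt_lim_sin.
  + intros; apply continuity_pt_filterlim, continuous_sin.
  + rewrite Hc; replace (v * y - v * x) with (- (v * (x - y))) by ring.
    rewrite Rabs_mult, Rabs_Ropp, Rabs_mult.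
    rewrite <- (Rmult_1_l (Rabs v * _)) at 2.
    apply Rmult_le_compat_r; [apply Rmult_le_pos; apply Rabs_pos|].
    apply Rabs_le, COS_bound.
- apply Rabs_pos.
- set (t := fun k => (-1) ^ k * (isq (k + n0) * - sin (v * lnS (k + n0)))) in *.
  (* Shifting the index by [n0] changes only the overall sign. *)
  assert (Ht : forall k, (-1) ^ n0 * t k = im_eta_term v (k + n0)).
  { intro k; unfold im_eta_term, t; rewrite pow_add; ring. }
  split.
  + apply ex_series_ext with (fun k => (-1) ^ n0 * t k); [exact Ht|].
    now apply (@ex_series_scal R_AbsRing R_NormedModule).
  + rewrite <- (Series_ext _ _ Ht), Series_scal_l, Rabs_mult, pow_1_abs; lra.
Qed.

Lemma im_eta_series v : is_series (im_eta_term v) (im_eta v).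
Proof.
unfold im_eta, eta; simpl.
rewrite (Series_ext _ (im_eta_term v)) by (intro; apply Im_eta_term).
apply Series_correct.
destruct (im_eta_tail v 0) as [H _]; revert H; apply ex_series_ext.
intro k; f_equal; lia.
Qed.

(** This error, small in [N] and linear in [v], yields continuity of [im_eta] and later justifies
    integrating the series term by term. *)
Lemma im_eta_approx v N :
  Rabs (im_eta v - sum_n (im_eta_term v) N) <= (1 + 2 * Rabs v) * isq (S N).
Proof.
destruct (im_eta_tail v (S N)) as [_ H].
rewrite <- (is_series_unique _ _ (im_eta_series v)).
rewrite (Series_incr_n (im_eta_term v) (S N)); [|lia|eexists; apply im_eta_series].
rewrite <- sum_n_Reals in *; simpl pred.
rewrite (Series_ext _ (fun k => im_eta_term v (k + S N))) by (intro; f_equal; lia).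
replace (_ + _ - _) with (Series (fun k => im_eta_term v (k + S N))) by ring.
exact H.
Qed.

Lemma im_eta_bound v : Rabs (im_eta v) <= 1 + 2 * Rabs v.
Proof.
rewrite <- (is_series_unique _ _ (im_eta_series v)).
destruct (im_eta_tail v 0) as [_ H].
rewrite (Series_ext _ (fun k => im_eta_term v (k + 0))) by (intro; f_equal; lia).
eapply Rle_trans; [apply H|].
pose proof (isq_le_1 0); pose proof (Rabs_pos v); nra.
Qed.

Lemma continuous_im_eta_term v k : continuous (fun v => im_eta_term v k) v.
Proof.
apply (ex_derive_continuous (fun v => im_eta_term v k)).
unfold im_eta_term; auto_derive; trivial.
Qed.

Lemma continuous_sum_im_eta_term v N : continuous (fun v => sum_n (im_eta_term v) N) v.
Proof.
induction N as [|N IH].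
- apply continuous_ext with (fun v => im_eta_term v 0);
    [intro; now rewrite sum_O|apply continuous_im_eta_term].
- apply continuous_ext with (fun v => plus (sum_n (im_eta_term v) N) (im_eta_term v (S N)));
    [intro; now rewrite sum_Sn|].
  apply (continuous_plus (fun v => sum_n (im_eta_term v) N)); [exact IH|apply continuous_im_eta_term].
Qed.

(** The partial sums are continuous and converge locally uniformly. *)
Lemma continuous_im_eta v : continuous im_eta v.
Proof.
apply filterlim_locally; intros [e He]; simpl.
(* [A] bounds [1 + 2 * Rabs y] for every [y] within distance 1 of [v]. *)
set (A := 3 + 2 * Rabs v); assert (HA : 0 < A) by (unfold A; pose proof (Rabs_pos v); lra).
assert (He' : 0 < e / (4 * A)) by (apply Rdiv_lt_0_compat; lra).
destruct (proj1 (filterlim_locally _ _) is_lim_seq_isq (mkposreal _ He')) as [N HN].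
assert (HN' : A * isq (S N) < e / 4).
{ specialize (HN (S N) ltac:(lia)).
  assert (H0 : Rabs (isq (S N) - 0) < e / (4 * A)) by exact HN.
  rewrite Rminus_0_r, Rabs_pos_eq in H0 by (left; apply isq_pos).
  apply (Rmult_lt_compat_l A) in H0; [|lra].
  replace (A * (e / (4 * A))) with (e / 4) in H0 by (field; lra). exact H0. }
assert (He4 : 0 < e / 4) by lra.
pose proof (proj1 (filterlim_locally _ _) (continuous_sum_im_eta_term v N) (mkposreal _ He4)) as HC.
assert (H1 : locally v (fun y => Rabs (y - v) < 1)) by (exists (mkposreal 1 Rlt_0_1); intros y Hy; exact Hy).
generalize (filter_and _ _ HC H1); apply filter_imp; intros y [Hy1 Hy2].
assert (Hy1' : Rabs (sum_n (im_eta_term y) N - sum_n (im_eta_term v) N) < e / 4) by exact Hy1.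
change (Rabs (im_eta y - im_eta v) < e).
pose proof (im_eta_approx v N) as Hv; pose proof (im_eta_approx y N) as Hy.
pose proof (isq_pos (S N)).
assert (Rabs y <= Rabs v + 1).
{ replace y with (v + (y - v)) by ring. eapply Rle_trans; [apply Rabs_triang|lra]. }
assert (Hb1 : (1 + 2 * Rabs y) * isq (S N) <= A * isq (S N))
  by (apply Rmult_le_compat_r; unfold A; lra).
assert (Hb2 : (1 + 2 * Rabs v) * isq (S N) <= A * isq (S N))
  by (apply Rmult_le_compat_r; unfold A; lra).
apply Rabs_le_between in Hv; apply Rabs_le_between in Hy; apply Rabs_lt_between in Hy1'.
apply Rabs_lt_between; lra.
Qed.

(** * Improper integrals with exponential decay *)

Definition is_int (f : R -> R) (l : R) : Prop :=
  is_RInt_gen f (at_point 0) (Rbar_locally p_infty) l.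

Lemma is_int_unique f l : is_int f l ->
  RInt_gen f (at_point 0) (Rbar_locally p_infty) = l.
Proof. apply (is_RInt_gen_unique (V := R_CompleteNormedModule)). Qed.

Lemma is_int_ext f g l : (forall x, f x = g x) -> is_int f l -> is_int g l.
Proof.
intro H; apply is_RInt_gen_ext.
apply filter_forall; intros; apply H.
Qed.

Lemma is_int_plus f g lf lg :
  is_int f lf -> is_int g lg -> is_int (fun x => f x + g x) (lf + lg).
Proof. apply (is_RInt_gen_plus f g). Qed.

Lemma is_int_minus f g lf lg :
  is_int f lf -> is_int g lg -> is_int (fun x => f x - g x) (lf - lg).
Proof. apply (is_RInt_gen_minus f g). Qed.

Lemma is_int_scal f (c l : R) : is_int f l -> is_int (fun x => c * f x) (c * l).
Proof. apply (is_RInt_gen_scal f c). Qed.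

Lemma is_int_lim (f : R -> R) (I : R -> R) (l : R) :
  (forall x, is_RInt f 0 x (I x)) -> is_lim I p_infty l -> is_int f l.
Proof.
intros HI Hl P HP.
destruct (Hl P HP) as [m Hm].
apply Filter_prod with (eq 0) (fun x => m < x).
- reflexivity.
- now exists m.
- intros x y <- Hy; exists (I y); split; [apply HI|now apply Hm].
Qed.

Lemma is_lim_exp_bound (g : R -> R) (K b : R) :
  0 < b -> (forall x, 0 <= x -> Rabs (g x) <= K * exp (- (b * x))) ->
  is_lim g p_infty 0.
Proof.
intros Hb Hg.
assert (HE : is_lim (fun x => K * exp (- (b * x))) p_infty 0).
{ replace (Finite 0) with (Rbar_mult (Finite K) (Finite 0)) by (simpl; f_equal; ring).
  apply is_lim_scal_l.
  apply is_lim_comp with m_infty; [apply is_lim_exp_m| |now exists 0].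
  replace m_infty with (Rbar_opp p_infty) by reflexivity. apply is_lim_opp.
  replace p_infty with (Rbar_mult (Finite b) p_infty) at 2.
  - apply is_lim_scal_l, is_lim_id.
  - apply is_Rbar_mult_unique, is_Rbar_mult_sym, is_Rbar_mult_p_infty_pos; exact Hb. }
assert (HN : is_lim (fun x => - (K * exp (- (b * x)))) p_infty 0).
{ replace (Finite 0) with (Rbar_opp (Finite 0)) by (simpl; f_equal; ring).
  now apply is_lim_opp. }
apply is_lim_le_le_loc with (3 := HE) (2 := HN).
exists 0; intros x Hx; apply Rabs_le_between, Hg; lra.
Qed.

Lemma is_int_antiderivative (A f : R -> R) (K b : R) :
  0 < b -> (forall x, is_derive A x (f x)) -> (forall x, continuous f x) ->
  (forall x, 0 <= x -> Rabs (A x) <= K * exp (- (b * x))) ->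
  is_int f (- A 0).
Proof.
intros Hb HA Hf HK.
apply is_int_lim with (fun x => A x - A 0).
- intro x; apply (is_RInt_derive A f); intros; [apply HA|apply Hf].
- replace (- A 0) with (0 - A 0) by ring.
  apply is_lim_minus'; [now apply is_lim_exp_bound with K b|apply is_lim_const].
Qed.

Lemma is_int_exp (K b : R) : 0 < b -> is_int (fun x => K * exp (- (b * x))) (K / b).
Proof.
intro Hb.
replace (K / b) with (- (- (K / b) * exp (- (b * 0))))
  by (rewrite Rmult_0_r, Ropp_0, exp_0; ring).
apply (is_int_antiderivative (fun x => - (K / b) * exp (- (b * x)))) with (Rabs (K / b)) b.
- exact Hb.
- intro x; auto_derive; [trivial|field; lra].
- intro x; apply (ex_derive_continuous (fun x => K * exp (- (b * x)))); auto_derive; trivial.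
- intros x _; rewrite Rabs_mult, Rabs_Ropp, (Rabs_pos_eq (exp _)) by (left; apply exp_pos); lra.
Qed.

(** The integral over [[x, y]] is at most [K / b * exp (- (b * x))], so the Cauchy criterion gives
    convergence; the bound on [l] comes from comparison with the integral of the dominating
    exponential. *)
Lemma is_int_dominated (f : R -> R) (K b : R) :
  0 < b -> (forall x, continuous f x) ->
  (forall x, 0 <= x -> Rabs (f x) <= K * exp (- (b * x))) ->
  exists l, is_int f l /\ Rabs l <= K / b.
Proof.
intros Hb Hf HK.
assert (Hex : forall x y, ex_RInt f x y).
{ intros x y; apply (@ex_RInt_continuous R_CompleteNormedModule); intros; apply Hf. }
assert (HK0 : 0 <= K).
{ specialize (HK 0 ltac:(lra)); rewrite Rmult_0_r, Ropp_0, exp_0 in HK.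
  pose proof (Rabs_pos (f 0)); lra. }
assert (Hle : forall x y, 0 <= x <= y -> Rabs (RInt f x y) <= K / b * exp (- (b * x))).
{ intros x y Hxy.
  assert (HI : is_RInt (fun t => K * exp (- (b * t))) x y
    (- (K / b) * exp (- (b * y)) - - (K / b) * exp (- (b * x)))).
  { apply (is_RInt_derive (fun t => - (K / b) * exp (- (b * t)))).
    - intros t _; auto_derive; [trivial|field; lra].
    - intros t _; apply (ex_derive_continuous (fun x => K * exp (- (b * x)))); auto_derive; trivial. }
  eapply Rle_trans.
  - apply (norm_RInt_le f (fun t => K * exp (- (b * t))) x y); [lra| | |exact HI].
    + intros t Ht; apply HK; lra.
    + apply (RInt_correct f), Hex.
  - pose proof (exp_pos (- (b * y))).
    assert (0 <= K / b) by (apply Rdiv_le_0_compat; lra). nra. }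
destruct (proj1 (filterlim_locally_cauchy (F := Rbar_locally' p_infty) (fun x => RInt f 0 x))) as [l Hl].
- intros [e He].
  assert (H0 := is_lim_exp_bound (fun x => K / b * exp (- (b * x))) (K / b) b Hb).
  assert (H1 : is_lim (fun x => K / b * exp (- (b * x))) p_infty 0).
  { apply H0; intros x _; rewrite Rabs_pos_eq; [lra|].
    apply Rmult_le_pos; [apply Rdiv_le_0_compat; lra|left; apply exp_pos]. }
  assert (Hl0 : locally 0 (fun y => Rabs y < e)).
  { exists (mkposreal e He); intros y Hy.
    change (Rabs (y - 0) < e) in Hy; now rewrite Rminus_0_r in Hy. }
  destruct (H1 _ Hl0) as [m Hm].
  exists (fun x => Rmax 0 m < x); split; [now exists (Rmax 0 m)|].
  assert (Hsub : forall u v, Rmax 0 m < u -> u <= v -> Rabs (RInt f 0 v - RInt f 0 u) < e).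
  { intros u v Hu Huv; pose proof (Rmax_l 0 m); pose proof (Rmax_r 0 m).
    assert (E : RInt f 0 u + RInt f u v = RInt f 0 v) by (apply (RInt_Chasles f); apply Hex).
    rewrite <- E, Rplus_comm; unfold Rminus; rewrite Rplus_assoc, Rplus_opp_r, Rplus_0_r.
    eapply Rle_lt_trans; [apply Hle; lra|].
    eapply Rle_lt_trans; [apply Rle_abs|apply Hm; lra]. }
  intros u v Hu Hv; change (Rabs (RInt f 0 v - RInt f 0 u) < e).
  destruct (Rle_dec u v); [now apply Hsub|].
  rewrite Rabs_minus_sym; apply Hsub; [assumption|lra].
- assert (Hil : is_int f l).
  { apply is_int_lim with (fun x => RInt f 0 x); [intro x; apply (RInt_correct f), Hex|exact Hl]. }
  exists l; split; [exact Hil|].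
  apply (RInt_gen_norm (Fa := at_point 0) (Fb := Rbar_locally p_infty) f
           (fun x => K * exp (- (b * x)))); [| |exact Hil|now apply is_int_exp].
  + apply Filter_prod with (eq 0) (fun x => 0 < x); [reflexivity|now exists 0|].
    intros x y <- Hy; simpl; lra.
  + apply Filter_prod with (eq 0) (fun x => 0 < x); [reflexivity|now exists 0|].
    intros x y <- Hy t Ht; apply HK; apply Ht.
Qed.

(** Trades a factor [v] for an arbitrarily small loss [c] in the exponential rate. *)
Lemma le_exp_scaled (c v : R) : 0 < c -> v <= / c * exp (c * v).
Proof.
intro Hc; pose proof (exp_ineq1_le (c * v)).
apply Rmult_le_reg_l with c; [lra|].
rewrite <- Rmult_assoc, Rinv_r, Rmult_1_l by lra; lra.
Qed.

(** * Complex-valued improper integrals, taken by components *)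

Lemma Cmod_le_abs (z : C) : Cmod z <= Rabs (Re z) + Rabs (Im z).
Proof.
rewrite <- sqrt_Rsqr by (pose proof (Rabs_pos (Re z)); pose proof (Rabs_pos (Im z)); lra).
apply sqrt_le_1_alt; unfold Rsqr, Re, Im.
rewrite <- (pow2_abs (fst z)), <- (pow2_abs (snd z)).
pose proof (Rabs_pos (fst z)); pose proof (Rabs_pos (snd z)); nra.
Qed.

Lemma im_le_Cmod (z : C) : Rabs (Im z) <= Cmod z.
Proof. eapply Rle_trans; [apply Rmax_r|apply Rmax_Cmod]. Qed.

Definition is_cint (f : R -> C) (l : C) : Prop :=
  is_int (fun v => Re (f v)) (Re l) /\ is_int (fun v => Im (f v)) (Im l).

Definition cint (f : R -> C) : C :=
  (RInt_gen (fun v => Re (f v)) (at_point 0) (Rbar_locally p_infty),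
   RInt_gen (fun v => Im (f v)) (at_point 0) (Rbar_locally p_infty)).

Lemma is_cint_unique f l : is_cint f l -> cint f = l.
Proof.
intros [H1 H2]; unfold cint; rewrite (is_int_unique _ _ H1), (is_int_unique _ _ H2).
now destruct l.
Qed.

Lemma is_cint_minus f g lf lg :
  is_cint f lf -> is_cint g lg -> is_cint (fun x => f x - g x)%C (lf - lg)%C.
Proof. intros [H1 H2] [H3 H4]; split; now apply is_int_minus. Qed.

Lemma is_cint_scal f (c l : C) : is_cint f l -> is_cint (fun x => c * f x)%C (c * l)%C.
Proof.
intros [H1 H2]; split.
- apply (is_int_minus (fun v => Re c * Re (f v)) (fun v => Im c * Im (f v)));
    now apply is_int_scal.
- apply (is_int_plus (fun v => Re c * Im (f v)) (fun v => Im c * Re (f v)));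
    now apply is_int_scal.
Qed.

Definition ccontinuous (f : R -> C) : Prop :=
  forall x, continuous (fun v => Re (f v)) x /\ continuous (fun v => Im (f v)) x.

(** The factor 2 arises because the real and imaginary parts are estimated separately. *)
Lemma is_cint_dominated (f : R -> C) (K b : R) :
  0 < b -> ccontinuous f ->
  (forall x, 0 <= x -> Cmod (f x) <= K * exp (- (b * x))) ->
  is_cint f (cint f) /\ Cmod (cint f) <= 2 * (K / b).
Proof.
intros Hb Hf HK.
destruct (is_int_dominated (fun v => Re (f v)) K b Hb) as [l1 [H1 H1']].
- intro x; apply (Hf x).
- intros x Hx; eapply Rle_trans; [apply re_le_Cmod|now apply HK].
- destruct (is_int_dominated (fun v => Im (f v)) K b Hb) as [l2 [H2 H2']].
  + intro x; apply (Hf x).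
  + intros x Hx; eapply Rle_trans; [apply im_le_Cmod|now apply HK].
  + assert (H : is_cint f (l1, l2)) by now split.
    rewrite (is_cint_unique _ _ H); split; [exact H|].
    eapply Rle_trans; [apply Cmod_le_abs|simpl; lra].
Qed.

(** * Taylor bounds for the complex exponential *)

Lemma exp_nondecreasing (x y : R) : x <= y -> exp x <= exp y.
Proof. intros [H| ->]; [left; now apply exp_increasing|apply Rle_refl]. Qed.

Lemma Cexp_plus (z w : C) : Cexp (z + w) = (Cexp z * Cexp w)%C.
Proof.
apply injective_projections; simpl; rewrite exp_plus, ?cos_plus, ?sin_plus; unfold Re, Im; ring.
Qed.

Lemma Cmod_Cexp (z : C) : Cmod (Cexp z) = exp (Re z).
Proof.
unfold Cmod, Cexp; simpl.
transitivity (sqrt ((exp (Re z))² * ((sin (Im z))² + (cos (Im z))²))).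
- f_equal; unfold Rsqr; ring.
- rewrite sin2_cos2, Rmult_1_r; apply sqrt_Rsqr; left; apply exp_pos.
Qed.

(** Locating [c] by its distance from [x] avoids ordering the endpoints; with [x = 0], a bound on
    [f'] in terms of [Rabs c] becomes one in terms of [Rabs y]. The remainder bounds below all arise
    so, with constants left crude. *)
Lemma MVT_between (f f' : R -> R) (x y : R) :
  (forall t, is_derive f t (f' t)) ->
  exists c, Rabs (c - x) <= Rabs (y - x) /\ f y - f x = f' c * (y - x).
Proof.
intro Hf; destruct (MVT_gen f x y f') as [c [H1 H2]].
- intros; apply Hf.
- intros t _; apply continuity_pt_filterlim, (ex_derive_continuous f); eexists; apply Hf.
- exists c; split; [|exact H2].
  unfold Rmin, Rmax in H1; destruct (Rle_dec x y).
  + rewrite !Rabs_pos_eq; lra.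
  + rewrite !Rabs_left1; lra.
Qed.

Lemma sin_lipschitz (x y : R) : Rabs (sin x - sin y) <= Rabs (x - y).
Proof.
destruct (MVT_between sin cos y x) as [c [_ ->]].
- intro; apply is_derive_Reals, derivable_pt_lim_sin.
- rewrite Rabs_mult; rewrite <- Rmult_1_l; apply Rmult_le_compat_r; [apply Rabs_pos|].
  apply Rabs_le, COS_bound.
Qed.

Lemma cos_lipschitz (x y : R) : Rabs (cos x - cos y) <= Rabs (x - y).
Proof.
destruct (MVT_between cos (fun t => - sin t) y x) as [c [_ ->]].
- intro; apply is_derive_Reals, derivable_pt_lim_cos.
- rewrite Rabs_mult, Rabs_Ropp; rewrite <- Rmult_1_l; apply Rmult_le_compat_r; [apply Rabs_pos|].
  apply Rabs_le, SIN_bound.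
Qed.

Lemma cos_minus_1_bound (y : R) : Rabs (cos y - 1) <= y ^ 2.
Proof.
destruct (MVT_between cos (fun t => - sin t) 0 y) as [c [Hc E]].
- intro; apply is_derive_Reals, derivable_pt_lim_cos.
- rewrite cos_0 in E; rewrite E; rewrite !Rminus_0_r in *.
  pose proof (sin_lipschitz c 0) as H; rewrite sin_0, !Rminus_0_r in H.
  rewrite Rabs_mult, Rabs_Ropp, <- (pow2_abs y); pose proof (Rabs_pos y); nra.
Qed.

Lemma sin_minus_id_bound (y : R) : Rabs (sin y - y) <= y ^ 2.
Proof.
destruct (MVT_between (fun t => sin t - t) (fun t => cos t - 1) 0 y) as [c [Hc E]].
- intro; auto_derive; [trivial|ring].
- rewrite sin_0, !Rminus_0_r in *; rewrite E.
  pose proof (cos_lipschitz c 0) as H; rewrite cos_0, !Rminus_0_r in H.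
  rewrite Rabs_mult, <- (pow2_abs y); pose proof (Rabs_pos y); nra.
Qed.

Lemma exp_minus_1_bound (x : R) : Rabs (exp x - 1) <= Rabs x * exp (Rabs x).
Proof.
destruct (MVT_between exp exp 0 x) as [c [Hc E]].
- intro; apply is_derive_Reals, derivable_pt_lim_exp.
- rewrite exp_0 in E; rewrite E; rewrite !Rminus_0_r in *.
  rewrite Rabs_mult, Rabs_pos_eq, Rmult_comm by (left; apply exp_pos).
  apply Rmult_le_compat_l; [apply Rabs_pos|].
  apply exp_nondecreasing; pose proof (Rle_abs c); lra.
Qed.

Lemma exp_taylor1_bound (x : R) : Rabs (exp x - 1 - x) <= x ^ 2 * exp (Rabs x).
Proof.
destruct (MVT_between (fun t => exp t - 1 - t) (fun t => exp t - 1) 0 x) as [c [Hc E]].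
- intro; auto_derive; [trivial|ring].
- rewrite exp_0, !Rminus_0_r in *; replace (exp x - 1 - x) with ((exp c - 1) * x) by lra.
  pose proof (exp_minus_1_bound c) as H.
  assert (exp (Rabs c) <= exp (Rabs x)) by now apply exp_nondecreasing.
  pose proof (exp_pos (Rabs c)); pose proof (Rabs_pos c); pose proof (Rabs_pos x).
  rewrite Rabs_mult, <- (pow2_abs x).
  apply Rle_trans with (Rabs x * exp (Rabs x) * Rabs x); [|lra].
  apply Rmult_le_compat_r; [lra|].
  eapply Rle_trans; [exact H|]. apply Rmult_le_compat; lra.
Qed.

Lemma Cexp_taylor1_bound (w : C) :
  Cmod (Cexp w - 1 - w) <= 5 * Cmod w ^ 2 * exp (Cmod w).
Proof.
eapply Rle_trans; [apply Cmod_le_abs|].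
destruct w as [x y]; set (m := Cmod (x, y)).
assert (Hx : Rabs x <= m) by apply (re_le_Cmod (x, y)).
assert (Hy : Rabs y <= m) by apply (im_le_Cmod (x, y)).
simpl.
pose proof (Rabs_pos x); pose proof (Rabs_pos y); pose proof (exp_pos (Rabs x)).
assert (He : exp (Rabs x) <= exp m) by now apply exp_nondecreasing.
assert (Hex : exp x <= exp m) by (apply exp_nondecreasing; pose proof (Rle_abs x); lra).
pose proof (exp_pos x).
pose proof (exp_taylor1_bound x) as B1; pose proof (exp_minus_1_bound x) as B2.
pose proof (cos_minus_1_bound y) as B3; pose proof (sin_minus_id_bound y) as B4.
rewrite <- pow2_abs in B1, B3, B4.
assert (Hx2 : Rabs x ^ 2 <= m ^ 2) by (apply pow_incr; lra).
assert (Hy2 : Rabs y ^ 2 <= m ^ 2) by (apply pow_incr; lra).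
(* Real and imaginary parts are regrouped into four products, each at most [m ^ 2 * exp m]; the
   constant 5 leaves some slack. *)
replace (exp x * cos y + - (1) + - x) with ((exp x - 1 - x) + exp x * (cos y - 1)) by ring.
replace (exp x * sin y + - 0 + - y) with (exp x * (sin y - y) + y * (exp x - 1)) by ring.
assert (A1 : Rabs (exp x - 1 - x) <= m ^ 2 * exp m).
{ eapply Rle_trans; [exact B1|]; apply Rmult_le_compat; try lra; apply pow2_ge_0. }
assert (A2 : Rabs (exp x * (cos y - 1)) <= exp m * m ^ 2).
{ rewrite Rabs_mult, (Rabs_pos_eq (exp x)) by lra.
  apply Rmult_le_compat; try lra; apply Rabs_pos. }
assert (A3 : Rabs (exp x * (sin y - y)) <= exp m * m ^ 2).
{ rewrite Rabs_mult, (Rabs_pos_eq (exp x)) by lra.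
  apply Rmult_le_compat; try lra; apply Rabs_pos. }
assert (A4 : Rabs (y * (exp x - 1)) <= m * (m * exp m)).
{ rewrite Rabs_mult; apply Rmult_le_compat; try lra; try apply Rabs_pos.
  eapply Rle_trans; [exact B2|]; apply Rmult_le_compat; lra. }
eapply Rle_trans; [apply Rplus_le_compat; apply Rabs_triang|].
assert (0 <= m ^ 2 * exp m) by (apply Rmult_le_pos; [apply pow2_ge_0|left; apply exp_pos]).
change (m * (m * 1)) with (m ^ 2). nra.
Qed.

(** * Holomorphy of Laplace transforms *)

(* A quadratic remainder is stronger than differentiability, but composes by plain
   arithmetic and passes through sums and integrals. *)
Definition quad_derivative (W : C -> C) (z l : C) : Prop :=
  exists M r, 0 < r /\ forall d : C, Cmod d < r ->
    Cmod (W (z + d) - W z - l * d)%C <= M * Cmod d ^ 2.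

(** The kernel has the sign [exp (+ z v)], so a weight decaying at rate [a] gives convergence on the
    left half-plane [Re z < a]. *)
Definition laplace (h : R -> R) (z : C) : C :=
  cint (fun v => RtoC (h v) * Cexp (z * RtoC v))%C.

Lemma continuous_mult_R (f g : R -> R) x :
  continuous f x -> continuous g x -> continuous (fun y => f y * g y) x.
Proof. apply (continuous_mult f g). Qed.

Lemma ccontinuous_laplace (h : R -> R) (z : C) :
  (forall x, continuous h x) -> ccontinuous (fun v => RtoC (h v) * Cexp (z * RtoC v))%C.
Proof.
intros Hh x; destruct z as [a b]; split.
- apply continuous_ext with (fun v => h v * (exp (a * v) * cos (b * v))).
  + intro v; simpl. replace (a * v - b * 0) with (a * v) by ring.
    replace (a * 0 + b * v) with (b * v) by ring. ring.
  + apply continuous_mult_R; [apply Hh|].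
    apply (ex_derive_continuous (fun v => exp (a * v) * cos (b * v))); auto_derive; trivial.
- apply continuous_ext with (fun v => h v * (exp (a * v) * sin (b * v))).
  + intro v; simpl. replace (a * v - b * 0) with (a * v) by ring.
    replace (a * 0 + b * v) with (b * v) by ring. ring.
  + apply continuous_mult_R; [apply Hh|].
    apply (ex_derive_continuous (fun v => exp (a * v) * sin (b * v))); auto_derive; trivial.
Qed.

Lemma Cmod_laplace_kernel (z : C) (c v : R) :
  Cmod (RtoC c * Cexp (z * RtoC v))%C = Rabs c * exp (Re z * v).
Proof.
rewrite Cmod_mult, Cmod_R, Cmod_Cexp; do 2 f_equal; simpl; unfold Re; ring.
Qed.

Lemma is_cint_laplace (h : R -> R) (K a : R) (z : C) :
  (forall x, continuous h x) ->
  (forall v, 0 <= v -> Rabs (h v) <= K * exp (- (a * v))) ->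
  Re z < a ->
  is_cint (fun v => RtoC (h v) * Cexp (z * RtoC v))%C (laplace h z).
Proof.
intros Hc Hh Hz; unfold laplace.
refine (proj1 (is_cint_dominated _ K (a - Re z) ltac:(lra) _ _)).
- now apply ccontinuous_laplace.
- intros v Hv; rewrite Cmod_laplace_kernel.
  replace (- ((a - Re z) * v)) with (- (a * v) + Re z * v) by ring.
  rewrite exp_plus, <- Rmult_assoc.
  apply Rmult_le_compat_r; [left; apply exp_pos|now apply Hh].
Qed.

(** Differentiation under the integral sign: the remainder is the integral of [h v * Cexp (z v)]
    times [Cexp (d v) - 1 - d v], and the last factor is of order [|d|^2 v^2 exp (|d| v)]. *)
Lemma quad_derivative_laplace (h : R -> R) (K a : R) (z : C) :
  (forall x, continuous h x) ->
  (forall v, 0 <= v -> Rabs (h v) <= K * exp (- (a * v))) ->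
  Re z < a ->
  quad_derivative (laplace h) z (laplace (fun v => v * h v) z).
Proof.
intros Hc Hh Hz.
(* The decay available is [4 * b]: one [b] absorbs [v ^ 2], another absorbs [exp (|d| v)], and
   [2 * b] remains for integrability. *)
set (b := (a - Re z) / 4); assert (Hb : 0 < b) by (unfold b; lra).
assert (HK0 : 0 <= K).
{ specialize (Hh 0 ltac:(lra)); rewrite Rmult_0_r, Ropp_0, exp_0 in Hh.
  pose proof (Rabs_pos (h 0)); lra. }
assert (Hc1 : forall x, continuous (fun v => v * h v) x).
{ intro x; apply continuous_mult_R; [apply continuous_id|apply Hc]. }
assert (Hh1 : forall v, 0 <= v -> Rabs (v * h v) <= / b * K * exp (- ((a - b) * v))).
{ intros v Hv; rewrite Rabs_mult, (Rabs_pos_eq v) by lra.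
  replace (- ((a - b) * v)) with (b * v + - (a * v)) by ring; rewrite exp_plus.
  replace (/ b * K * (exp (b * v) * exp (- (a * v)))) with
    ((/ b * exp (b * v)) * (K * exp (- (a * v)))) by ring.
  apply Rmult_le_compat; [lra|apply Rabs_pos|now apply le_exp_scaled|now apply Hh]. }
(* The 5 is from [Cexp_taylor1_bound], and [(2 / b) ^ 2] from bounding [v ^ 2] by
   [(2 / b) ^ 2 * exp (b * v)]. *)
set (M := 5 * K * (2 / b) ^ 2).
exists (2 * (M / (2 * b))), b; split; [exact Hb|]; intros d Hd.
assert (Hre : Rabs (Re d) <= Cmod d) by apply re_le_Cmod.
assert (I1 := is_cint_laplace h K a (z + d) Hc Hh).
assert (I2 := is_cint_laplace h K a z Hc Hh Hz).
assert (I3 := is_cint_laplace (fun v : R => v * h v) _ (a - b) z Hc1 Hh1 : _ -> is_cint _ (laplace (fun v : R => v * h v) z)).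
assert (Hzd : Re (z + d) < a).
{ change (Re z + Re d < a); pose proof (Rle_abs (Re d)).
  assert (4 * b = a - Re z) by (unfold b; field); lra. }
specialize (I1 Hzd); specialize (I3 ltac:(unfold b; lra)).
assert (I := is_cint_minus _ _ _ _ (is_cint_minus _ _ _ _ I1 I2) (is_cint_scal _ d _ I3)).
rewrite (Cmult_comm _ d).
rewrite <- (is_cint_unique _ _ I).
apply Rle_trans with (2 * (M * Cmod d ^ 2 / (2 * b))); [|right; field; lra].
eapply proj2; apply is_cint_dominated with (b := 2 * b); [lra| |].
- intro x; pose proof (ccontinuous_laplace h (z + d) Hc x) as [C1 C2].
  pose proof (ccontinuous_laplace h z Hc x) as [C3 C4].
  pose proof (ccontinuous_laplace _ z Hc1 x) as [C5 C6].
  split.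
  + apply (continuous_minus (V := R_NormedModule)); [now apply (continuous_minus (V := R_NormedModule))|].
    apply (continuous_minus (V := R_NormedModule)); apply continuous_mult_R;
      try apply continuous_const; assumption.
  + apply (continuous_minus (V := R_NormedModule)); [now apply (continuous_minus (V := R_NormedModule))|].
    apply (continuous_plus (V := R_NormedModule)); apply continuous_mult_R;
      try apply continuous_const; assumption.
- intros v Hv.
  replace (_ - _ - _)%C with
    (RtoC (h v) * Cexp (z * RtoC v) * (Cexp (d * RtoC v) - 1 - d * RtoC v))%C.
  2: { rewrite Cmult_plus_distr_r, Cexp_plus, RtoC_mult; ring. }
  rewrite Cmod_mult, Cmod_laplace_kernel.
  pose proof (Cexp_taylor1_bound (d * RtoC v)) as HT.
  rewrite Cmod_mult, Cmod_R, (Rabs_pos_eq v) in HT by lra.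
  pose proof (Cmod_ge_0 d) as Hd0.
  assert (Hv2 : v ^ 2 <= (2 / b) ^ 2 * exp (b * v)).
  { replace (b * v) with (b / 2 * v + b / 2 * v) by field; rewrite exp_plus.
    assert (Hle := le_exp_scaled (b / 2) v ltac:(lra)).
    replace (/ (b / 2)) with (2 / b) in Hle by (field; lra).
    replace ((2 / b) ^ 2 * (exp (b / 2 * v) * exp (b / 2 * v))) with ((2 / b * exp (b / 2 * v)) ^ 2) by ring.
    apply pow_incr; lra. }
  assert (HT' : Cmod (Cexp (d * RtoC v) - 1 - d * RtoC v) <=
     5 * Cmod d ^ 2 * ((2 / b) ^ 2 * exp (b * v)) * exp (b * v)).
  { eapply Rle_trans; [exact HT|].
    replace (5 * (Cmod d * v) ^ 2) with (5 * Cmod d ^ 2 * v ^ 2) by ring.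
    assert (0 <= 5 * Cmod d ^ 2) by (pose proof (pow2_ge_0 (Cmod d)); lra).
    apply Rmult_le_compat.
    - apply Rmult_le_pos; [lra|apply pow2_ge_0].
    - left; apply exp_pos.
    - now apply Rmult_le_compat_l.
    - apply exp_nondecreasing, Rmult_le_compat_r; lra. }
  apply Rle_trans with ((K * exp (- (a * v)) * exp (Re z * v)) *
    (5 * Cmod d ^ 2 * ((2 / b) ^ 2 * exp (b * v)) * exp (b * v))).
  + apply Rmult_le_compat; [|apply Cmod_ge_0| |exact HT'].
    * apply Rmult_le_pos; [apply Rabs_pos|left; apply exp_pos].
    * apply Rmult_le_compat_r; [left; apply exp_pos|now apply Hh].
  + right; unfold M.
    replace (- (2 * b * v)) with (- (a * v) + Re z * v + b * v + b * v) by (unfold b; field).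
    rewrite !exp_plus; ring.
Qed.

(** * The pole series *)

Definition is_csum (a : nat -> C) (l : C) : Prop :=
  is_series (fun k => Re (a k)) (Re l) /\ is_series (fun k => Im (a k)) (Im l).

Definition csum (a : nat -> C) : C :=
  (Series (fun k => Re (a k)), Series (fun k => Im (a k))).

Lemma is_csum_unique a l : is_csum a l -> csum a = l.
Proof.
intros [H1 H2]; unfold csum.
rewrite (is_series_unique _ _ H1), (is_series_unique _ _ H2); now destruct l.
Qed.

Lemma is_csum_ext a b l : (forall k, a k = b k) -> is_csum a l -> is_csum b l.
Proof.
intros H [H1 H2]; split; [revert H1|revert H2]; apply is_series_ext;
  intro k; now rewrite H.
Qed.

Lemma is_csum_minus a b la lb :
  is_csum a la -> is_csum b lb -> is_csum (fun k => a k - b k)%C (la - lb)%C.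
Proof.
intros [H1 H2] [H3 H4]; split.
- now apply (is_series_minus (fun k => Re (a k)) (fun k => Re (b k))).
- now apply (is_series_minus (fun k => Im (a k)) (fun k => Im (b k))).
Qed.

Lemma is_csum_scal a (c l : C) : is_csum a l -> is_csum (fun k => c * a k)%C (c * l)%C.
Proof.
intros [H1 H2]; split.
- apply (is_series_minus (fun k => Re c * Re (a k)) (fun k => Im c * Im (a k)));
    now apply (@is_series_scal R_AbsRing R_NormedModule).
- apply (is_series_plus (fun k => Re c * Im (a k)) (fun k => Im c * Re (a k)));
    now apply (@is_series_scal R_AbsRing R_NormedModule).
Qed.

(** The data [B], [K] required by [alternating_log_series], for complex coefficients. Closure under
    sums and products extends the estimate from [pole] to polynomials in such functions. *)
Definition bounded_lipschitz (x0 : R) (f : R -> C) (B K : R) : Prop :=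
  (forall x, x0 <= x -> Cmod (f x) <= B) /\
  (forall x y, x0 <= x -> x0 <= y -> Cmod (f x - f y) <= K * Rabs (x - y)) /\ 0 <= K.

Lemma bounded_lipschitz_mult x0 f g B K B' K' :
  bounded_lipschitz x0 f B K -> bounded_lipschitz x0 g B' K' ->
  bounded_lipschitz x0 (fun x => f x * g x)%C (B * B') (B * K' + K * B').
Proof.
intros [H1 [H2 H3]] [H4 [H5 H6]].
assert (HB : 0 <= B) by (eapply Rle_trans; [apply Cmod_ge_0|apply (H1 x0), Rle_refl]).
assert (HB' : 0 <= B') by (eapply Rle_trans; [apply Cmod_ge_0|apply (H4 x0), Rle_refl]).
split; [|split].
- intros x Hx; rewrite Cmod_mult; apply Rmult_le_compat; try apply Cmod_ge_0; auto.
- intros x y Hx Hy.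
  replace (f x * g x - f y * g y)%C with (f x * (g x - g y) + (f x - f y) * g y)%C by ring.
  eapply Rle_trans; [apply Cmod_triangle|]; rewrite !Cmod_mult.
  rewrite Rmult_plus_distr_r; apply Rplus_le_compat.
  + rewrite Rmult_assoc; apply Rmult_le_compat; try apply Cmod_ge_0; auto.
  + replace (K * B' * Rabs (x - y)) with (K * Rabs (x - y) * B') by ring.
    apply Rmult_le_compat; try apply Cmod_ge_0; auto.
- pose proof (Rmult_le_pos _ _ HB H6); pose proof (Rmult_le_pos _ _ H3 HB'); lra.
Qed.

Lemma bounded_lipschitz_plus x0 f g B K B' K' :
  bounded_lipschitz x0 f B K -> bounded_lipschitz x0 g B' K' ->
  bounded_lipschitz x0 (fun x => f x + g x)%C (B + B') (K + K').
Proof.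
intros [H1 [H2 H3]] [H4 [H5 H6]]; split; [|split; [|lra]].
- intros x Hx; eapply Rle_trans; [apply Cmod_triangle|].
  specialize (H1 x Hx); specialize (H4 x Hx); lra.
- intros x y Hx Hy.
  replace (f x + g x - (f y + g y))%C with ((f x - f y) + (g x - g y))%C by ring.
  eapply Rle_trans; [apply Cmod_triangle|].
  specialize (H2 x y Hx Hy); specialize (H5 x y Hx Hy); lra.
Qed.

Lemma bounded_lipschitz_const x0 (c : C) : bounded_lipschitz x0 (fun _ => c) (Cmod c) 0.
Proof.
split; [|split; [|lra]]; intros; [lra|].
replace (c - c)%C with (RtoC 0) by ring; rewrite Cmod_0; lra.
Qed.

(** The bound depends on [psi] only through [B] and [K], which makes it uniform when [psi] varies
    with a parameter. *)
Lemma csum_alternating_log (psi : R -> C) (B K : R) (n0 : nat) :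
  bounded_lipschitz (lnS n0) psi B K ->
  let a k := (RtoC ((-1) ^ k * isq (k + n0)) * psi (lnS (k + n0)))%C in
  is_csum a (csum a) /\ Cmod (csum a) <= 2 * (B + 2 * K).
Proof.
intros [H1 [H2 H3]] a.
assert (HB : 0 <= B) by (eapply Rle_trans; [apply Cmod_ge_0|apply (H1 (lnS n0)), Rle_refl]).
destruct (alternating_log_series (fun x => Re (psi x)) B K n0) as [C1 D1].
- intros x Hx; eapply Rle_trans; [apply re_le_Cmod|auto].
- intros x y Hx Hy; eapply Rle_trans; [apply (re_le_Cmod (psi x - psi y))|auto].
- exact H3.
- destruct (alternating_log_series (fun x => Im (psi x)) B K n0) as [C2 D2].
  + intros x Hx; eapply Rle_trans; [apply im_le_Cmod|auto].
  + intros x y Hx Hy; eapply Rle_trans; [apply (im_le_Cmod (psi x - psi y))|auto].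
  + exact H3.
  + assert (E1 : forall k, (-1) ^ k * (isq (k + n0) * Re (psi (lnS (k + n0)))) = Re (a k))
      by (intro k; unfold a; simpl; unfold Re; ring).
    assert (E2 : forall k, (-1) ^ k * (isq (k + n0) * Im (psi (lnS (k + n0)))) = Im (a k))
      by (intro k; unfold a; simpl; unfold Im; ring).
    rewrite (Series_ext _ _ E1) in D1; rewrite (Series_ext _ _ E2) in D2.
    split; [split; apply Series_correct|].
    * revert C1; now apply ex_series_ext.
    * revert C2; now apply ex_series_ext.
    * eapply Rle_trans; [apply Cmod_le_abs|].
      change (Rabs (Series (fun k => Re (a k))) + Rabs (Series (fun k => Im (a k)))
              <= 2 * (B + 2 * K)).
      assert ((B + 2 * K) * isq n0 <= B + 2 * K).
      { rewrite <- (Rmult_1_r (B + 2 * K)) at 2.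
        apply Rmult_le_compat_l; [lra|apply isq_le_1]. }
      lra.
Qed.

Definition pole (z : C) (x : R) : C := (/ (z - Ci * RtoC x))%C.

(** The singularity [i x] lies on the imaginary axis, at vertical distance [x - Im z] above [z] when
    this is positive. *)
Lemma pole_den_lower (z : C) (x : R) : x - Im z <= Cmod (z - Ci * RtoC x).
Proof.
eapply Rle_trans; [|apply im_le_Cmod]; rewrite <- Rabs_Ropp.
eapply Rle_trans; [|apply Rle_abs]; simpl; unfold Im; lra.
Qed.

(** The Lipschitz bound is the resolvent identity: a difference of two poles is [i (x - y)] times
    their product. *)
Lemma bounded_lipschitz_pole (z : C) (x0 r : R) :
  0 < r -> Im z + r <= x0 -> bounded_lipschitz x0 (pole z) (/ r) (/ r * / r).
Proof.
intros Hr Hz.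
assert (Hn : forall x, x0 <= x -> (z - Ci * RtoC x)%C <> 0%C).
{ intros x Hx; apply Cmod_gt_0; pose proof (pole_den_lower z x); lra. }
assert (Hb : forall x, x0 <= x -> Cmod (pole z x) <= / r).
{ intros x Hx; unfold pole; rewrite Cmod_inv by auto.
  apply Rinv_le_contravar; [lra|]; pose proof (pole_den_lower z x); lra. }
assert (0 < / r) by now apply Rinv_0_lt_compat.
split; [exact Hb|split; [|nra]].
intros x y Hx Hy.
replace (pole z x - pole z y)%C with (Ci * RtoC (x - y) * (pole z x * pole z y))%C.
- rewrite !Cmod_mult, Cmod_R.
  assert (HCi : Cmod Ci = 1)
    by (unfold Cmod; simpl; transitivity (sqrt 1); [f_equal; ring|apply sqrt_1]).
  rewrite HCi, Rmult_1_l, Rmult_comm; apply Rmult_le_compat_r; [apply Rabs_pos|].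
  apply Rmult_le_compat; try apply Cmod_ge_0; auto.
- unfold pole; rewrite RtoC_minus; field; auto.
Qed.

(** The function [V] of the overview. Here n = k + 2, so [(-1) ^ k] equals [(-1) ^ n] and the
    nearest singularity is at [i * lnS 1], that is [i ln 2]. *)
Definition pole2_series (z : C) : C :=
  csum (fun k => RtoC ((-1) ^ k * isq (k + 1)) * (pole z (lnS (k + 1)) * pole z (lnS (k + 1))))%C.

Lemma is_csum_pole2_series (z : C) :
  Im z < lnS 1 ->
  is_csum (fun k => RtoC ((-1) ^ k * isq (k + 1)) *
     (pole z (lnS (k + 1)) * pole z (lnS (k + 1))))%C (pole2_series z).
Proof.
intro Hz.
assert (H := bounded_lipschitz_pole z (lnS 1) (lnS 1 - Im z) ltac:(lra) ltac:(lra)).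
exact (proj1 (csum_alternating_log _ _ _ 1 (bounded_lipschitz_mult _ _ _ _ _ _ _ H H))).
Qed.

(** Write q and p for the poles at [z] and [z + d]. Since p - q = - d p q, the termwise remainder
    p^2 - q^2 + 2 d q^3 equals d^2 p q^2 (p + 2 q), whose alternating sum is bounded uniformly in
    [d]. *)
Lemma quad_derivative_pole2_series (z : C) :
  Im z < lnS 1 -> exists l, quad_derivative pole2_series z l.
Proof.
(* Half the distance to the line [Im = ln 2], so that [z + d] stays at least [r] below it when
   [Cmod d < r]. *)
intro Hz; set (r := (lnS 1 - Im z) / 2); assert (Hr : 0 < r) by (unfold r; lra).
assert (E2r : 2 * r = lnS 1 - Im z) by (unfold r; field).
assert (Hq := bounded_lipschitz_pole z (lnS 1) r Hr ltac:(lra)).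
set (q := pole z) in *.
assert (Hm := bounded_lipschitz_mult (lnS 1)).
assert (H3 := Hm _ _ _ _ _ _ (bounded_lipschitz_const _ ((- RtoC 2)%C))
                 (Hm _ _ _ _ _ _ Hq (Hm _ _ _ _ _ _ Hq Hq))).
destruct (csum_alternating_log _ _ _ 1 H3) as [S3 _].
exists (csum (fun k => RtoC ((-1) ^ k * isq (k + 1)) *
   ((- RtoC 2)%C * (q (lnS (k + 1)) * (q (lnS (k + 1)) * q (lnS (k + 1))))))%C).
assert (HM : exists M, forall d : C, Cmod d < r ->
  let psi x := (pole (z + d) x * (q x * q x) * (pole (z + d) x + RtoC 2 * q x))%C in
  let a k := (RtoC ((-1) ^ k * isq (k + 1)) * psi (lnS (k + 1)))%C in
  is_csum a (csum a) /\ Cmod (csum a) <= M).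
(* The bound is chosen before [d], hence is the same for all small [d]. *)
{ eexists; intros d Hd.
  assert (Hp : bounded_lipschitz (lnS 1) (pole (z + d)) (/ r) (/ r * / r)).
  { apply bounded_lipschitz_pole; [exact Hr|].
    pose proof (im_le_Cmod d); pose proof (Rle_abs (Im d)).
    change (Im z + Im d + r <= lnS 1); lra. }
  apply csum_alternating_log.
  apply Hm; [apply Hm; [exact Hp|apply Hm; exact Hq]|].
  apply bounded_lipschitz_plus; [exact Hp|].
  apply Hm; [apply bounded_lipschitz_const|exact Hq]. }
destruct HM as [M HM]; exists M, r; split; [exact Hr|]; intros d Hd.
destruct (HM d Hd) as [S S']; clear HM.
assert (Hzd : Im (z + d) + r <= lnS 1).
{ pose proof (im_le_Cmod d); pose proof (Rle_abs (Im d)).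
  change (Im z + Im d + r <= lnS 1); lra. }
assert (S1 := is_csum_pole2_series (z + d) ltac:(lra)).
assert (S2 := is_csum_pole2_series z ltac:(lra)).
assert (T := is_csum_minus _ _ _ _ (is_csum_minus _ _ _ _ S1 S2) (is_csum_scal _ d _ S3)).
apply is_csum_scal with (c := (d * d)%C) in S.
rewrite (Cmult_comm _ d).
rewrite <- (is_csum_unique _ _ T).
eapply is_csum_ext in S; [rewrite (is_csum_unique _ _ S)|].
- rewrite !Cmod_mult; pose proof (Cmod_ge_0 d).
  replace (M * Cmod d ^ 2) with (Cmod d * Cmod d * M) by ring.
  apply Rmult_le_compat_l; [nra|exact S'].
- intro k; simpl; unfold q, pole; set (L := lnS (k + 1)).
  assert (HL : lnS 1 <= L) by (apply lnS_incr; lia).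
  assert (N1 : (z - Ci * RtoC L)%C <> 0%C).
  { apply Cmod_gt_0; pose proof (pole_den_lower z L); lra. }
  assert (N2 : (z + d - Ci * RtoC L)%C <> 0%C).
  { apply Cmod_gt_0; pose proof (pole_den_lower (z + d) L); lra. }
  field; auto.
Qed.

(** * The damped integral *)

(** The value is the imaginary part of [1 / (e - i L)^2], the Laplace integral of
    [v * exp (i L v)]. *)
Lemma is_int_damped_sine (e L : R) : 0 < e ->
  is_int (fun v => v * sin (v * L) * exp (- (e * v))) (2 * e * L / (e ^ 2 + L ^ 2) ^ 2).
Proof.
intro He; set (D := e ^ 2 + L ^ 2).
assert (HD : 0 < D) by (unfold D; nra).
(* With p = e - i L, this is the imaginary part of [- exp (- p v) * (v / p + 1 / p^2)]. *)
set (A := fun v => - exp (- (e * v)) *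
  ((v * (e / D) + (e ^ 2 - L ^ 2) / D ^ 2) * sin (v * L) +
   (v * (L / D) + 2 * e * L / D ^ 2) * cos (v * L))).
replace (2 * e * L / D ^ 2) with (- A 0).
2: { unfold A; rewrite Rmult_0_r, Ropp_0, exp_0, !Rmult_0_l, sin_0, cos_0; field; lra. }
set (a1 := Rabs (e / D)); set (a2 := Rabs ((e ^ 2 - L ^ 2) / D ^ 2)).
set (a3 := Rabs (L / D)); set (a4 := Rabs (2 * e * L / D ^ 2)).
assert (0 <= a1) by apply Rabs_pos. assert (0 <= a2) by apply Rabs_pos.
assert (0 <= a3) by apply Rabs_pos. assert (0 <= a4) by apply Rabs_pos.
(* Half of the damping rate pays for the linear factor of the antiderivative. *)
apply is_int_antiderivative with (/ (e / 2) * (a1 + a3) + (a2 + a4)) (e / 2).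
- lra.
- intro x; unfold A; auto_derive; [trivial|]. unfold D in *; field; lra.
- intro x; apply (ex_derive_continuous (fun v => v * sin (v * L) * exp (- (e * v))));
    auto_derive; trivial.
- intros x Hx; unfold A.
  assert (Hs : Rabs (sin (x * L)) <= 1) by apply Rabs_le, SIN_bound.
  assert (Hc : Rabs (cos (x * L)) <= 1) by apply Rabs_le, COS_bound.
  rewrite Rabs_mult, Rabs_Ropp, (Rabs_pos_eq (exp _)) by (left; apply exp_pos).
  assert (HS : Rabs ((x * (e / D) + (e ^ 2 - L ^ 2) / D ^ 2) * sin (x * L) +
     (x * (L / D) + 2 * e * L / D ^ 2) * cos (x * L)) <= x * (a1 + a3) + (a2 + a4)).
  { eapply Rle_trans; [apply Rabs_triang|]; rewrite !Rabs_mult.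
    assert (Rabs (x * (e / D) + (e ^ 2 - L ^ 2) / D ^ 2) <= x * a1 + a2).
    { eapply Rle_trans; [apply Rabs_triang|].
      rewrite Rabs_mult, (Rabs_pos_eq x) by lra; fold a1 a2; lra. }
    assert (Rabs (x * (L / D) + 2 * e * L / D ^ 2) <= x * a3 + a4).
    { eapply Rle_trans; [apply Rabs_triang|].
      rewrite Rabs_mult, (Rabs_pos_eq x) by lra; fold a3 a4; lra. }
    pose proof (Rabs_pos (x * (e / D) + (e ^ 2 - L ^ 2) / D ^ 2)).
    pose proof (Rabs_pos (x * (L / D) + 2 * e * L / D ^ 2)).
    nra. }
  pose proof (le_exp_scaled (e / 2) x ltac:(lra)) as Hx1.
  assert (Hx2 : 1 <= exp (e / 2 * x)).
  { rewrite <- exp_0; apply exp_nondecreasing, Rmult_le_pos; lra. }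
  assert (HS' : x * (a1 + a3) + (a2 + a4) <=
     (/ (e / 2) * (a1 + a3) + (a2 + a4)) * exp (e / 2 * x)).
  { apply (Rmult_le_compat_r (a1 + a3)) in Hx1; [|lra].
    apply (Rmult_le_compat_l (a2 + a4)) in Hx2; [|lra]. lra. }
  replace (- (e / 2 * x)) with (- (e * x) + e / 2 * x) by field.
  rewrite exp_plus, Rmult_comm.
  pose proof (exp_pos (- (e * x))).
  apply (Rmult_le_compat_r (exp (- (e * x)))) in HS; [|lra].
  apply (Rmult_le_compat_r (exp (- (e * x)))) in HS'; [|lra].
  lra.
Qed.

Lemma pole_real (e L : R) : e <> 0 ->
  pole (RtoC e) L = (e / (e ^ 2 + L ^ 2), L / (e ^ 2 + L ^ 2)).
Proof.
intro He; assert (0 < e ^ 2 + L ^ 2) by nra.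
apply injective_projections; unfold pole; simpl; field; nra.
Qed.

(** The growth bound of eta and the weight [v] each cost a rate [c]. *)
Lemma linear_growth_exp_bound (c v : R) : 0 < c -> 0 <= v ->
  (1 + 2 * v) * v <= (1 + 2 * / c) * / c * exp (2 * c * v).
Proof.
intros Hc Hv; pose proof (le_exp_scaled c v Hc) as H1.
assert (H2 : 1 <= exp (c * v)).
{ rewrite <- exp_0; apply exp_nondecreasing, Rmult_le_pos; lra. }
replace (2 * c * v) with (c * v + c * v) by ring; rewrite exp_plus.
replace ((1 + 2 * / c) * / c * (exp (c * v) * exp (c * v))) with
  ((exp (c * v) + 2 * (/ c * exp (c * v))) * (/ c * exp (c * v))) by ring.
apply Rmult_le_compat; lra.
Qed.

(** By [im_eta_approx], the truncated integrand differs from the full one by at most [isq (S N)]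
    times a fixed decaying exponential, so the integrals of the partial sums converge to the
    integral of the sum. *)
Lemma is_int_im_eta_exp (e : R) : 0 < e ->
  is_int (fun v => im_eta v * (v * exp (- (e * v)))) (Im (pole2_series (RtoC e))).
Proof.
intro He.
set (w := fun v => v * exp (- (e * v))).
set (t := fun k => (-1) ^ k * isq k * - (2 * e * lnS k / (e ^ 2 + lnS k ^ 2) ^ 2)).
assert (Hw : forall x, continuous w x).
{ intro x; apply (ex_derive_continuous w); unfold w; auto_derive; trivial. }
set (K := (1 + 2 * / (e / 4)) * / (e / 4)).
assert (HK : forall v, 0 <= v -> (1 + 2 * Rabs v) * Rabs (w v) <= K * exp (- (e / 2 * v))).
{ intros v Hv; unfold w; rewrite Rabs_mult, !(Rabs_pos_eq v), (Rabs_pos_eq (exp _)) by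
    (lra || (left; apply exp_pos)).
  pose proof (linear_growth_exp_bound (e / 4) v ltac:(lra) Hv) as H.
  replace (- (e / 2 * v)) with (2 * (e / 4) * v + - (e * v)) by field.
  rewrite exp_plus, <- !Rmult_assoc; fold K in H.
  apply Rmult_le_compat_r; [left; apply exp_pos|exact H]. }
assert (Hsum : forall N, is_int (fun v => sum_n (im_eta_term v) N * w v) (sum_n t N)).
{ assert (Hterm : forall k, is_int (fun v => im_eta_term v k * w v) (t k)).
  { intro k; unfold t.
    replace ((-1) ^ k * isq k * - (2 * e * lnS k / (e ^ 2 + lnS k ^ 2) ^ 2)) with
      (- ((-1) ^ k * isq k) * (2 * e * lnS k / (e ^ 2 + lnS k ^ 2) ^ 2)) by ring.
    eapply is_int_ext; [|apply is_int_scal, is_int_damped_sine, He].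
    intro v; unfold im_eta_term, w; ring. }
  induction N as [|N IH].
  - rewrite sum_O; eapply is_int_ext; [|apply Hterm]; intro v; now rewrite sum_O.
  - rewrite sum_Sn; eapply is_int_ext; [|apply is_int_plus; [apply IH|apply (Hterm (S N))]].
    intro v; rewrite sum_Sn; unfold plus; simpl; ring. }
destruct (is_int_dominated (fun v => im_eta v * w v) K (e / 2) ltac:(lra)) as [l [Hl _]].
- intro x; apply continuous_mult_R; [apply continuous_im_eta|apply Hw].
- intros v Hv; rewrite Rabs_mult; eapply Rle_trans; [|apply HK, Hv].
  apply Rmult_le_compat_r; [apply Rabs_pos|apply im_eta_bound].
- assert (Hdiff : forall N, Rabs (l - sum_n t N) <= isq (S N) * K / (e / 2)).
  { intro N.
    destruct (is_int_dominated (fun v => (im_eta v - sum_n (im_eta_term v) N) * w v)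
      (isq (S N) * K) (e / 2) ltac:(lra)) as [l' [Hl' Hb]].
    - intro x; apply continuous_mult_R; [|apply Hw].
      apply (continuous_minus (V := R_NormedModule));
        [apply continuous_im_eta|apply continuous_sum_im_eta_term].
    - intros v Hv; rewrite Rabs_mult, Rmult_assoc.
      apply Rle_trans with (isq (S N) * ((1 + 2 * Rabs v) * Rabs (w v))).
      + rewrite <- Rmult_assoc, (Rmult_comm (isq _)).
        apply Rmult_le_compat_r; [apply Rabs_pos|apply im_eta_approx].
      + apply Rmult_le_compat_l; [left; apply isq_pos|apply HK, Hv].
    - replace (l - sum_n t N) with l'; [exact Hb|].
      rewrite <- (is_int_unique _ _ Hl'); apply is_int_unique.
      eapply is_int_ext; [|apply is_int_minus; [apply Hl|apply (Hsum N)]].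
      intro v; simpl; ring. }
  assert (Ht : is_series t l).
  { change (is_lim_seq (sum_n t) l).
    apply is_lim_seq_ext with (fun N => l - (l - sum_n t N)); [intro N; ring|].
    replace (Finite l) with (Finite (l - 0)) by (f_equal; ring).
    apply is_lim_seq_minus'; [apply is_lim_seq_const|].
    apply is_lim_seq_abs_0.
    apply is_lim_seq_le_le with (fun _ => 0) (fun N => isq (S N) * (K / (e / 2))).
    - intro N; split; [apply Rabs_pos|].
      eapply Rle_trans; [apply Hdiff|right; unfold Rdiv; ring].
    - apply is_lim_seq_const.
    - replace (Finite 0) with (Finite (0 * (K / (e / 2)))) by (f_equal; ring).
      apply is_lim_seq_mult'; [|apply is_lim_seq_const].
      apply -> is_lim_seq_incr_1; apply is_lim_seq_isq. }
  replace (Im (pole2_series (RtoC e))) with l; [exact Hl|].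
  (* The n = 1 term drops out because ln 1 = 0. After the index shift, the extra sign cancels the
     minus in [- sin]. *)
  assert (Ht0 : t O = 0).
  { unfold t, lnS; simpl; rewrite Rplus_0_l, ln_1; unfold Rdiv; ring. }
  rewrite <- (is_series_unique _ _ Ht), Series_incr_1 by (eexists; apply Ht).
  rewrite Ht0, Rplus_0_l.
  change (Im (pole2_series (RtoC e))) with
    (Series (fun k => Im (RtoC ((-1) ^ k * isq (k + 1)) *
      (pole (RtoC e) (lnS (k + 1)) * pole (RtoC e) (lnS (k + 1))))%C)).
  apply Series_ext; intro k; unfold t.
  rewrite Nat.add_1_r, pole_real by lra; simpl Im.
  set (L := lnS (S k)); simpl pow; assert (0 < e * e + L * L) by nra.
  field; nra.
Qed.

(** Each [1 / (- e - i L)^2] is the conjugate of [1 / (e - i L)^2]. Thus on the real axis the odd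
    difference is [2 i] times the imaginary part, which replaces the non-holomorphic [Im] by a
    holomorphic expression. *)
Lemma pole2_series_opp (e : R) : 0 < e ->
  pole2_series (RtoC (- e)) = Cconj (pole2_series (RtoC e)).
Proof.
intro He; apply injective_projections.
- apply Series_ext; intro k; rewrite !pole_real by lra; simpl.
  set (L := lnS (k + 1)); assert (0 < e * e + L * L) by nra; field; nra.
- change (Series (fun k => Im (RtoC ((-1) ^ k * isq (k + 1)) *
      (pole (RtoC (- e)) (lnS (k + 1)) * pole (RtoC (- e)) (lnS (k + 1))))%C) =
    - Series (fun k => Im (RtoC ((-1) ^ k * isq (k + 1)) *
      (pole (RtoC e) (lnS (k + 1)) * pole (RtoC e) (lnS (k + 1))))%C)).
  rewrite <- Series_opp.
  apply Series_ext; intro k; rewrite !pole_real by lra; simpl.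
  set (L := lnS (k + 1)); assert (0 < e * e + L * L) by nra; field; nra.
Qed.

Definition remainder_weight (v : R) : R :=
  im_eta v * (v * (exp (- (PI * v)) / cosh (PI * v))).

Lemma cosh_pos (x : R) : 0 < cosh x.
Proof. unfold cosh; pose proof (exp_pos x); pose proof (exp_pos (- x)); lra. Qed.

Lemma continuous_remainder_weight x : continuous remainder_weight x.
Proof.
apply continuous_mult_R; [apply continuous_im_eta|].
apply (ex_derive_continuous (fun v => v * (exp (- (PI * v)) / cosh (PI * v)))).
unfold cosh; auto_derive; repeat split.
fold (cosh (PI * x)). pose proof (cosh_pos (PI * x)) as H; unfold cosh in H; lra.
Qed.

(** The hyperbolic factor is at most [2 * exp (- (2 * PI * v))], and the gap [2 * PI - a] absorbs
    the polynomial growth. *)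
Lemma remainder_weight_bound (a : R) : a < 2 * PI ->
  exists K, forall v, 0 <= v -> Rabs (remainder_weight v) <= K * exp (- (a * v)).
Proof.
intro Ha; set (c := (2 * PI - a) / 2); assert (Hc : 0 < c) by (unfold c; lra).
exists ((1 + 2 * / c) * / c * 2); intros v Hv; unfold remainder_weight.
pose proof (cosh_pos (PI * v)) as Hch; pose proof (exp_pos (- (PI * v))).
assert (Hq : exp (- (PI * v)) / cosh (PI * v) <= 2 * exp (- (2 * PI * v))).
{ apply Rmult_le_reg_r with (cosh (PI * v)); [exact Hch|].
  unfold Rdiv; rewrite Rmult_assoc, Rinv_l, Rmult_1_r by lra.
  unfold cosh; pose proof (exp_pos (- (2 * PI * v))).
  replace (exp (- (PI * v))) with (exp (- (2 * PI * v)) * exp (PI * v)) at 1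
    by (rewrite <- exp_plus; f_equal; ring).
  nra. }
assert (Hq0 : 0 < exp (- (PI * v)) / cosh (PI * v)) by now apply Rdiv_lt_0_compat.
rewrite !Rabs_mult, (Rabs_pos_eq v), (Rabs_pos_eq (_ / _)) by lra.
pose proof (im_eta_bound v) as Hb; rewrite (Rabs_pos_eq v) in Hb by lra.
pose proof (linear_growth_exp_bound c v Hc Hv) as Hl.
apply Rle_trans with ((1 + 2 * / c) * / c * exp (2 * c * v) * (2 * exp (- (2 * PI * v)))).
- rewrite <- Rmult_assoc; apply Rmult_le_compat; [|lra| |exact Hq].
  + apply Rmult_le_pos; [apply Rabs_pos|lra].
  + eapply Rle_trans; [|exact Hl]; apply Rmult_le_compat_r; lra.
- right; replace (- (a * v)) with (2 * c * v + - (2 * PI * v)) by (unfold c; field).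
  rewrite exp_plus; ring.
Qed.

Lemma laplace_remainder_real (x : R) : x < 2 * PI ->
  is_int (fun v => remainder_weight v * exp (x * v)) (Re (laplace remainder_weight (RtoC x))) /\
  Im (laplace remainder_weight (RtoC x)) = 0.
Proof.
intro Hx; destruct (remainder_weight_bound ((x + 2 * PI) / 2)) as [K HK]; [lra|].
destruct (is_cint_laplace remainder_weight K ((x + 2 * PI) / 2) (RtoC x)) as [H1 H2].
- apply continuous_remainder_weight.
- exact HK.
- simpl; lra.
- split.
  + revert H1; apply is_int_ext; intro v; simpl.
    replace (x * v - 0 * 0) with (x * v) by ring.
    replace (x * 0 + 0 * v) with 0 by ring. rewrite cos_0; ring.
  + rewrite <- (is_int_unique _ _ H2); apply is_int_unique.
    (* The imaginary integrand vanishes pointwise at real arguments, so it is also its own multiple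
       by zero. *)
    replace 0 with (0 * Im (laplace remainder_weight (RtoC x))) by ring.
    eapply is_int_ext; [|apply (is_int_scal _ 0 _ H2)].
    intro v; simpl.
    replace (x * 0 + 0 * v) with 0 by ring. rewrite sin_0; ring.
Qed.

(** * The continuation in the damping parameter and its value at [PI] *)

Definition odd_difference (W : C -> C) (z : C) : C := (W z - W (- z))%C.

Definition continuation (phi : C) : C :=
  (RtoC (/ 2) * odd_difference (laplace remainder_weight) (RtoC PI - phi) -
   Ci * RtoC (/ 2) * odd_difference pole2_series (RtoC PI - phi))%C.

Lemma is_int_damped_integrand (phi : R) : - PI < phi < PI ->
  is_int (damped_integrand phi) (Re (continuation (RtoC phi))) /\
  Im (continuation (RtoC phi)) = 0.
Proof.
intro Hphi; set (e := PI - phi); assert (He : 0 < e < 2 * PI) by (unfold e; lra).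
destruct (laplace_remainder_real e ltac:(lra)) as [I1 J1].
destruct (laplace_remainder_real (- e) ltac:(lra)) as [I2 J2].
pose proof (is_int_im_eta_exp e ltac:(lra)) as I3.
unfold continuation, odd_difference; rewrite <- RtoC_minus; fold e.
rewrite <- RtoC_opp, pole2_series_opp by lra.
set (E1 := laplace remainder_weight (RtoC e)) in *.
set (E2 := laplace remainder_weight (RtoC (- e))) in *.
set (P := pole2_series (RtoC e)) in *.
(* Here [- i / 2] turns [P - Cconj P] into [Im P], and the two Laplace values are real. *)
assert (HR : (RtoC (/ 2) * (E1 - E2) - Ci * RtoC (/ 2) * (P - Cconj P))%C =
  RtoC (Im P + / 2 * (Re E1 - Re E2))).
{ clearbody E1 E2 P; destruct E1 as [x1 y1], E2 as [x2 y2], P as [p q].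
  simpl in J1, J2; subst y1 y2; apply injective_projections; simpl; field. }
rewrite HR; split; [|reflexivity].
change (is_int (damped_integrand phi) (Im P + / 2 * (Re E1 - Re E2))).
eapply is_int_ext; [|apply is_int_plus; [exact I3|apply is_int_scal, is_int_minus; [exact I1|exact I2]]].
intro v; unfold damped_integrand, remainder_weight; fold (im_eta v).
pose proof (cosh_pos (PI * v)) as Hc.
rewrite (Rmult_assoc (im_eta v) v).
(* Over the common denominator [cosh (PI * v)], the numerator must reduce to [cosh (phi * v)]. *)
transitivity (im_eta v * (v * ((exp (- (e * v)) * cosh (PI * v) +
   / 2 * exp (- (PI * v)) * (exp (e * v) - exp (- e * v))) / cosh (PI * v)))).
- field; lra.
- do 3 f_equal; unfold cosh, e.
  replace (- (PI - phi) * v) with (- (PI * v) + phi * v) by ring.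
  replace (- ((PI - phi) * v)) with (- (PI * v) + phi * v) by ring.
  replace ((PI - phi) * v) with (PI * v + - (phi * v)) by ring.
  rewrite !exp_plus.
  assert (HP : exp (- (PI * v)) * exp (PI * v) = 1)
    by (rewrite <- exp_plus, Rplus_opp_l; apply exp_0).
  transitivity ((exp (- (PI * v)) * exp (PI * v)) * exp (phi * v) / 2 +
    (exp (- (PI * v)) * exp (PI * v)) * exp (- (phi * v)) / 2); [field|].
  rewrite HP; field.
Qed.

Lemma quad_derivative_linear (f g : C -> C) (a b z lf lg : C) :
  quad_derivative f z lf -> quad_derivative g z lg ->
  quad_derivative (fun w => a * f w - b * g w)%C z (a * lf - b * lg)%C.
Proof.
intros [M [r [Hr H]]] [M' [r' [Hr' H']]].
exists (Cmod a * M + Cmod b * M'), (Rmin r r'); split; [now apply Rmin_glb_lt|].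
intros d Hd; pose proof (Rmin_l r r'); pose proof (Rmin_r r r').
specialize (H d ltac:(lra)); specialize (H' d ltac:(lra)).
replace (_ - _ - _)%C with
  (a * (f (z + d) - f z - lf * d) + - (b * (g (z + d) - g z - lg * d)))%C by ring.
eapply Rle_trans; [apply Cmod_triangle|]; rewrite Cmod_opp, !Cmod_mult.
apply (Rmult_le_compat_l (Cmod a)) in H; [|apply Cmod_ge_0].
apply (Rmult_le_compat_l (Cmod b)) in H'; [|apply Cmod_ge_0].
lra.
Qed.

Lemma quad_derivative_reflect (f : C -> C) (c z l : C) :
  quad_derivative f (c - z) l -> quad_derivative (fun w => f (c - w))%C z (- l)%C.
Proof.
intros [M [r [Hr H]]]; exists M, r; split; [exact Hr|]; intros d Hd.
specialize (H (- d)%C); rewrite Cmod_opp in H; specialize (H Hd).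
replace (c - (z + d))%C with (c - z + - d)%C by ring.
replace (_ - - l * d)%C with (f (c - z + - d) - f (c - z) - l * - d)%C by ring.
exact H.
Qed.

Lemma quad_derivative_ext (f g : C -> C) (z l : C) :
  (forall w, f w = g w) -> quad_derivative f z l -> quad_derivative g z l.
Proof.
intros E [M [r [Hr H]]]; exists M, r; split; [exact Hr|]; intros d Hd.
rewrite <- !E; now apply H.
Qed.

Lemma quad_derivative_odd_difference (f : C -> C) (z l l' : C) :
  quad_derivative f z l -> quad_derivative f (- z) l' ->
  quad_derivative (odd_difference f) z (l + l')%C.
Proof.
intros H H'.
assert (E0 : (0 - z)%C = (- z)%C) by ring.
rewrite <- E0 in H'.
assert (Q := quad_derivative_linear _ _ 1 1 _ _ _ H (quad_derivative_reflect _ _ _ _ H')).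
replace (1 * l - 1 * - l')%C with (l + l')%C in Q by ring.
revert Q; apply quad_derivative_ext; intro w; unfold odd_difference.
replace (0 - w)%C with (- w)%C by ring; ring.
Qed.

(** Exactly the points for which both [PI - z] and its negative have real part below [2 * PI] and
    imaginary part below ln 2, where the Laplace transform and the pole series are holomorphic. *)
Definition continuation_domain (z : C) : Prop :=
  - PI < Re z < 3 * PI /\ - lnS 1 < Im z < lnS 1.

Lemma quad_derivative_laplace_remainder (z : C) : Re z < 2 * PI ->
  exists l, quad_derivative (laplace remainder_weight) z l.
Proof.
intro Hz; destruct (remainder_weight_bound ((Re z + 2 * PI) / 2)) as [K HK]; [lra|].
eexists; apply quad_derivative_laplace with (2 := HK); [apply continuous_remainder_weight|lra].
Qed.

Lemma quad_derivative_continuation (z : C) : continuation_domain z ->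
  exists l, quad_derivative continuation z l.
Proof.
intros [H1 H2].
assert (R1 : Re (RtoC PI - z) = PI - Re z) by (simpl; unfold Re; ring).
assert (I1 : Im (RtoC PI - z) = - Im z) by (simpl; unfold Im; ring).
assert (R2 : Re (- (RtoC PI - z)) = Re z - PI) by (simpl; unfold Re; ring).
assert (I2 : Im (- (RtoC PI - z)) = Im z) by (simpl; unfold Im; ring).
destruct (quad_derivative_laplace_remainder (RtoC PI - z)) as [l1 Q1]; [lra|].
destruct (quad_derivative_laplace_remainder (- (RtoC PI - z))) as [l2 Q2]; [lra|].
destruct (quad_derivative_pole2_series (RtoC PI - z)) as [l3 Q3]; [lra|].
destruct (quad_derivative_pole2_series (- (RtoC PI - z))) as [l4 Q4]; [lra|].
eexists; apply quad_derivative_linear; apply quad_derivative_reflect;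
  apply quad_derivative_odd_difference; eassumption.
Qed.

Lemma quad_derivative_ex_derive (f : C -> C) (z l : C) :
  quad_derivative f z l -> ex_derive (K := C_AbsRing) (V := C_NormedModule) f z.
Proof.
intros [M [r [Hr H]]]; exists l; split; [apply is_linear_scal_l|].
intros x Hx.
assert (Ex : z = x) by (apply (is_filter_lim_locally_unique (K := C_AbsRing) (V := AbsRing_NormedModule C_AbsRing)); exact Hx).
subst x; intros [e He].
assert (HM : 0 < e / (Rabs M + 1)) by (apply Rdiv_lt_0_compat; pose proof (Rabs_pos M); lra).
(* Within this radius the quadratic remainder is at most [e] times the increment; [Rabs M + 1] is
   positive whatever the sign of [M]. *)
exists (mkposreal (Rmin r (e / (Rabs M + 1))) (Rmin_glb_lt _ _ _ Hr HM)).
change (forall y : C, Cmod (y - z) < Rmin r (e / (Rabs M + 1)) ->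
  Cmod (f y - f z - (y - z) * l) <= e * Cmod (y - z)).
intros y Hy.
pose proof (Rmin_l r (e / (Rabs M + 1))); pose proof (Rmin_r r (e / (Rabs M + 1))).
specialize (H (y - z)%C ltac:(lra)).
replace (z + (y - z))%C with y in H by ring.
rewrite (Cmult_comm (y - z) l); eapply Rle_trans; [exact H|].
assert (Hm : (Rabs M + 1) * Cmod (y - z) <= e).
{ apply Rle_trans with ((Rabs M + 1) * (e / (Rabs M + 1))).
  - apply Rmult_le_compat_l; [pose proof (Rabs_pos M)|]; lra.
  - right; field; pose proof (Rabs_pos M); lra. }
pose proof (Cmod_ge_0 (y - z)); pose proof (Rle_abs M).
apply Rle_trans with ((Rabs M + 1) * Cmod (y - z) * Cmod (y - z)); [|now apply Rmult_le_compat_r].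
simpl; rewrite Rmult_1_r, <- Rmult_assoc.
apply Rmult_le_compat_r; [lra|]; apply Rmult_le_compat_r; lra.
Qed.

Lemma lnS_1_pos : 0 < lnS 1.
Proof. unfold lnS; simpl; rewrite <- ln_1 at 1; apply ln_increasing; lra. Qed.

Lemma continuation_at_PI : continuation (RtoC PI) = RtoC 0.
Proof.
unfold continuation, odd_difference; rewrite <- RtoC_minus, Rminus_diag.
replace (- RtoC 0)%C with (RtoC 0) by ring; ring.
Qed.

Lemma open_continuation_domain : open continuation_domain.
Proof.
intros [x y] [[H1 H2] [H3 H4]]; simpl in *.
set (m := Rmin (Rmin (x + PI) (3 * PI - x)) (Rmin (y + lnS 1) (lnS 1 - y))).
assert (Hm : 0 < m) by (repeat apply Rmin_glb_lt; lra).
assert (m <= x + PI) by (unfold m; eapply Rle_trans; [apply Rmin_l|apply Rmin_l]).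
assert (m <= 3 * PI - x) by (unfold m; eapply Rle_trans; [apply Rmin_l|apply Rmin_r]).
assert (m <= y + lnS 1) by (unfold m; eapply Rle_trans; [apply Rmin_r|apply Rmin_l]).
assert (m <= lnS 1 - y) by (unfold m; eapply Rle_trans; [apply Rmin_r|apply Rmin_r]).
exists (mkposreal m Hm); intros [u v] [Hu Hv].
assert (Hu' : Rabs (u - x) < m) by exact Hu; assert (Hv' : Rabs (v - y) < m) by exact Hv.
apply Rabs_lt_between in Hu'; apply Rabs_lt_between in Hv'.
split; simpl; lra.
Qed.

Lemma damped_integral_continuation (phi : R) : - PI < phi < PI ->
  continuation (RtoC phi) = RtoC (damped_integral phi).
Proof.
intro H; destruct (is_int_damped_integrand phi H) as [H1 H2].
unfold damped_integral; rewrite (is_int_unique _ _ H1).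
now apply injective_projections.
Qed.

Lemma continuation_domain_real (x : R) : - PI < x <= PI -> continuation_domain (RtoC x).
Proof. intro H; pose proof lnS_1_pos; pose proof PI_RGT_0; split; simpl; lra. Qed.

Theorem mainTheorem10 :
  (forall phi : R, (Rabs phi < PI)%R -> ex_damped_integral phi) /\
  analytic_continuation_value damped_integral (- PI)%R PI 0%R /\
  filterlim damped_integral (at_left PI) (locally 0%R).
Proof.
pose proof PI_RGT_0.
split; [|split].
- intros phi Hphi; apply Rabs_lt_between in Hphi.
  eexists; apply (is_int_damped_integrand phi Hphi).
- exists continuation_domain, continuation; split; [|split; [|split; [|split]]].
  + apply open_continuation_domain.
  + apply continuation_domain_real.
  + intros z Hz; destruct (quad_derivative_continuation z Hz) as [l Hl].
    now apply quad_derivative_ex_derive with l.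
  + apply damped_integral_continuation.
  + apply continuation_at_PI.
(* The one-sided limit is the continuity of [continuation] at [PI] along the real axis, in the
   explicit form [|l| t + M t^2] with t the distance to [PI]. *)
- destruct (quad_derivative_continuation (RtoC PI)) as [l [M [r [Hr Q]]]].
  { apply continuation_domain_real; lra. }
  apply filterlim_locally; intros [e He].
  (* [r] validates the remainder bound, [2 * PI] keeps [y] above [- PI], 1 gives [t ^ 2 <= t], and
     the last entry makes the total less than [e]. *)
  set (m := Rmin (Rmin r (2 * PI)) (Rmin 1 (e / (Cmod l + Rabs M + 1)))).
  pose proof (Cmod_ge_0 l); pose proof (Rabs_pos M).
  assert (Hq : 0 < e / (Cmod l + Rabs M + 1)) by (apply Rdiv_lt_0_compat; lra).
  assert (Hm : 0 < m) by (repeat apply Rmin_glb_lt; lra).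
  assert (m <= r) by (unfold m; eapply Rle_trans; [apply Rmin_l|apply Rmin_l]).
  assert (m <= 2 * PI) by (unfold m; eapply Rle_trans; [apply Rmin_l|apply Rmin_r]).
  assert (m <= 1) by (unfold m; eapply Rle_trans; [apply Rmin_r|apply Rmin_l]).
  assert (m <= e / (Cmod l + Rabs M + 1))
    by (unfold m; eapply Rle_trans; [apply Rmin_r|apply Rmin_r]).
  exists (mkposreal m Hm).
  change (forall y : R, Rabs (y - PI) < m -> y < PI -> Rabs (damped_integral y - 0) < e).
  intros y Hy' HyPI; rewrite Rminus_0_r.
  specialize (Q (RtoC (y - PI))); rewrite Cmod_R in Q; specialize (Q ltac:(lra)).
  rewrite <- RtoC_plus in Q; replace (PI + (y - PI)) with y in Q by ring.
  rewrite damped_integral_continuation, continuation_at_PI in Q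
    by (apply Rabs_lt_between in Hy'; lra).
  rewrite <- Cmod_R.
  replace (RtoC (damped_integral y)) with
    ((RtoC (damped_integral y) - RtoC 0 - l * RtoC (y - PI)) + l * RtoC (y - PI))%C by ring.
  eapply Rle_lt_trans; [apply Cmod_triangle|]; rewrite (Cmod_mult l), Cmod_R.
  set (t := Rabs (y - PI)) in *; assert (0 <= t) by apply Rabs_pos.
  apply Rle_lt_trans with (t * (Cmod l + Rabs M)).
  + assert (M * t ^ 2 <= Rabs M * t).
    { pose proof (Rle_abs M); apply Rle_trans with (Rabs M * t ^ 2).
      - apply Rmult_le_compat_r; [apply pow2_ge_0|lra].
      - apply Rmult_le_compat_l; nra. }
    lra.
  + apply Rle_lt_trans with (e / (Cmod l + Rabs M + 1) * (Cmod l + Rabs M)).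
    * apply Rmult_le_compat_r; lra.
    * apply Rmult_lt_reg_r with (Cmod l + Rabs M + 1); [lra|].
      replace (e / (Cmod l + Rabs M + 1) * (Cmod l + Rabs M) * (Cmod l + Rabs M + 1))
        with (e * (Cmod l + Rabs M)) by (field; lra).
      nra.
Qed.
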